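(* The group $(E_6)^{\sigma_3}\cap(E_6)^{\mu_3}$ coincides with the group $(E_6)^{\sigma_3}$; that is, $(E_6)^{\sigma_3}\cap(E_6)^{\mu_3}$ is isomorphic to $(U(1)\times Spin(2)\times Spin(8))/(\mathbb{Z}_2\times\mathbb{Z}_4)$, where $\mathbb{Z}_2=\{(1,1,1),(1,\sigma,\sigma)\}$ and $\mathbb{Z}_4=\{(1,1,1),(i,D_{e_1},\phi(-i)D_{-e_1}),(-1,\sigma,1),(-i,D_{-e_1},\phi(i)D_{e_1})\}$.
   Context: Let $\mathbf{H}$ be the quaternions with units $e_1,e_2,e_3=e_1e_2$, and $\mathbf{C}=\{x+ye_1: x,y\in\mathbb{R}\}\subset\mathbf{H}$. Let $\mathfrak{C}=\mathbf{H}\oplus\mathbf{H}e_4$ be the division Cayley algebra with multiplication $(m+ne_4)(p+qe_4)=(mp-\bar q n)+(n\bar p+qm)e_4$ and conjugation $\overline{m+ne_4}=\bar m-ne_4$. Let $\mathfrak{J}=\{X\in M(3,\mathfrak{C}):X^*=X\}$, with elements $X=\begin{pmatrix}\xi_1&x_3&\overline{x_2}\\ \overline{x_3}&\xi_2&x_1\\ x_2&\overline{x_1}&\xi_3\end{pmatrix}$, $\xi_i\in\mathbb{R}$, $x_i\in\mathfrak{C}$, and with $X\circ Y=\tfrac12(XY+YX)$, $(X,Y)=\mathrm{tr}(X\circ Y)$, $X\times Y=\tfrac12(2X\circ Y-\mathrm{tr}(X)Y-\mathrm{tr}(Y)X+(\mathrm{tr}(X)\mathrm{tr}(Y)-(X,Y))E)$,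 $\det X=\tfrac13(X,X\times X)$. Let $E_1\in\mathfrak{J}$ be the element with $\xi_1=1$ and all other components $0$, and $F_1(x)\in\mathfrak{J}$ the element with $x_1=x$ and all other components $0$. Let $C=\{x+iy:x,y\in\mathbb{R}\}$, where $i$ commutes with all of $\mathfrak{C}$; let $\mathfrak{J}^C=\mathfrak{J}\oplus i\mathfrak{J}$ be the complexification with these operations extended $C$-linearly. Let $\tau$ denote complex conjugation with respect to $i$ and $\langle X,Y\rangle=(\tau X,Y)$. Put $E_6=\{\alpha\in\mathrm{Iso}_C(\mathfrak{J}^C):\det\alpha X=\det X,\ \langle\alpha X,\alpha Y\rangle=\langle X,Y\rangle\}$, where $\mathrm{Iso}_C$ denotes $C$-linear isomorphisms. For $a\in\mathbf{C}$ with $|a|=1$ let $D_a\in E_6$ be the $C$-linear extension of the map of $\mathfrak{J}$ fixing each $\xi_i$ and sending $x_1\mapsto\bar a x_1\bar a$, $x_2\mapsto ax_2$, $x_3\mapsto x_3a$. Put $\sigma=D_{-1}$ and $\sigma_3=D_{\boldsymbol{\omega}}$, $\boldsymbol{\omega}=-\tfrac12+\tfrac{\sqrt3}{2}e_1$. For $\theta\in U(1)=\{\theta\in C:(\tau\theta)\theta=1\}$ let $\phi(\theta)\in E_6$ be $$\phi(\theta)X=\begin{pmatrix}\theta^4\xi_1&\theta x_3&\theta\overline{x_2}\\ \theta\overline{x_3}&\theta^{-2}\xi_2&\theta^{-2}x_1\\ \theta x_2&\theta^{-2}\overline{x_1}&\theta^{-2}\xi_3\end{pmatrix},\quad X\in\mathfrak{J}^C,$$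 and put $\mu_3=\phi(\nu)$ with $\nu=\exp(2\pi i/9)\in C$. Here $Spin(2)$ denotes the group $\{D_a: a\in\mathbf{C},|a|=1\}$ and $Spin(8)$ denotes the group $\{\alpha\in E_6:\alpha E_1=E_1,\ \alpha F_1(1)=F_1(1),\ \alpha F_1(e_1)=F_1(e_1)\}$. For $g\in E_6$, $(E_6)^g=\{\alpha\in E_6:g^{-1}\alpha g=\alpha\}$. *)

(* Defs.v *)
From HB Require Import structures.
From mathcomp Require Import all_boot all_order all_algebra.
From mathcomp Require Import all_classical all_reals all_analysis.
From mathcomp Require Import complex.
From mathcomp Require Import ring.

Set Implicit Arguments.
Unset Strict Implicit.
Unset Printing Implicit Defensive.

Import Order.TTheory GRing.Theory Num.Theory.
Import numFieldNormedType.Exports.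

Local Open Scope classical_set_scope.
Local Open Scope ring_scope.
Local Open Scope complex_scope.

(* The real numbers are an arbitrary R : realType, and C = R + iR is R[i].
   Every algebra below is written over a coefficient field A. All the operations
   are given by polynomial formulas with rational coefficients, so that the
   instance A := R[i] is the complexification of the instance A := R, with the
   operations of the latter extended C-linearly. The copies A^o of A carry the
   A-module structure (and, for A := R[i], the topology) that the products below
   inherit. *)

Section Quaternions.
Variable A : fieldType.

(* (a, b, c, d) is a + b e1 + c e2 + d e3. *)
Definition quat : Type := (A^o * A^o * A^o * A^o)%type.

Definition qmul (p q : quat) : quat :=
  let: (a, b, c, d) := p in let: (a', b', c', d') := q in
  (a * a' - b * b' - c * c' - d * d',
   a * b' + b * a' + c * d' - d * c',
   a * c' - b * d' + c * a' + d * b',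
   a * d' + b * c' - c * b' + d * a').

Definition qconj (q : quat) : quat :=
  let: (a, b, c, d) := q in (a, - b, - c, - d).

(* (m, n) is m + n e4. *)
Definition cayley : Type := (quat * quat)%type.

Definition cmul (x y : cayley) : cayley :=
  let: (m, n) := x in let: (p, q) := y in
  (qmul m p - qmul (qconj q) n, qmul n (qconj p) + qmul q m).

Definition cconj (x : cayley) : cayley := let: (m, n) := x in (qconj m, - n).

Definition quat_cayley (q : quat) : cayley := (q, 0).
Definition scal_cayley (a : A) : cayley := quat_cayley (a, 0, 0, 0).
Definition cayley_re (x : cayley) : A := x.1.1.1.1.

Definition cayley_e1 : cayley := quat_cayley (0, 1, 0, 0).

End Quaternions.

Section Jordan.
Variable A : fieldType.

(* An element of the Jordan algebra is given by its coordinates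
   (xi1, xi2, xi3, x1, x2, x3); [jmx] below is the Hermitian matrix that it
   stands for, and [jmx_inj], [jmx_herm], [jmxP] say that [jmx] is a bijection
   onto the set of Hermitian matrices (when 2 != 0 in A). *)
Definition jordan : Type :=
  (A^o * A^o * A^o * cayley A * cayley A * cayley A)%type.

Definition jmx (X : jordan) : 'M[cayley A]_3 :=
  let: (xi1, xi2, xi3, x1, x2, x3) := X in
  \matrix_(i, j) nth 0 (nth [::]
    [:: [:: scal_cayley xi1; x3;              cconj x2];
        [:: cconj x3;        scal_cayley xi2; x1];
        [:: x2;              cconj x1;        scal_cayley xi3]] i) j.

Definition jcoord (M : 'M[cayley A]_3) : jordan :=
  let i0 := inord 0 : 'I_3 in
  let i1 := inord 1 : 'I_3 in
  let i2 := inord 2 : 'I_3 in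
  (cayley_re (M i0 i0), cayley_re (M i1 i1), cayley_re (M i2 i2),
   M i1 i2, M i2 i0, M i0 i1).

Definition cmx_star (M : 'M[cayley A]_3) : 'M[cayley A]_3 :=
  \matrix_(i, j) cconj (M j i).

Definition cmx_mul (M N : 'M[cayley A]_3) : 'M[cayley A]_3 :=
  \matrix_(i, j) \sum_(k < 3) cmul (M i k) (N k j).

Definition cmx_scale (a : A) (M : 'M[cayley A]_3) : 'M[cayley A]_3 :=
  \matrix_(i, j) (a *: M i j).

(* By [jmx_jcirc] the matrix of [jcirc X Y] is (XY + YX) / 2. *)
Definition jcirc (X Y : jordan) : jordan :=
  jcoord (cmx_scale 2^-1
            (cmx_mul (jmx X) (jmx Y) + cmx_mul (jmx Y) (jmx X))).

Definition jtr (X : jordan) : A :=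
  let: (xi1, xi2, xi3, _, _, _) := X in xi1 + xi2 + xi3.

Definition jdot (X Y : jordan) : A := jtr (jcirc X Y).

Definition jone : jordan := (1, 1, 1, 0, 0, 0).

Definition jcross (X Y : jordan) : jordan :=
  2^-1 *: (2 *: jcirc X Y - jtr X *: Y - jtr Y *: X
           + (jtr X * jtr Y - jdot X Y) *: jone).

Definition jdet (X : jordan) : A := 3^-1 * jdot X (jcross X X).

Definition jE1 : jordan := (1, 0, 0, 0, 0, 0).
Definition jF1 (x : cayley A) : jordan := (0, 0, 0, x, 0, 0).

End Jordan.

Section JordanMatrix.
Variable A : fieldType.
Implicit Types X Y : jordan A.

Lemma jmxK : cancel (@jmx A) (@jcoord A).
Proof.
move=> [[[[[u v] w] x] y] z]; rewrite /jcoord !mxE /= !inordK //=.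
Qed.

Lemma jmx_inj : injective (@jmx A).
Proof. exact: can_inj jmxK. Qed.

Lemma cconjK : involutive (@cconj A).
Proof.
by move=> [[[[a b] c] d] n]; rewrite /cconj /qconj /= !opprK.
Qed.

Lemma cconj_scal (a : A) : cconj (scal_cayley a) = scal_cayley a.
Proof. by rewrite /cconj /= !oppr0. Qed.

Let ord3E (P : 'I_3 -> Prop) :
  P (inord 0) -> P (inord 1) -> P (inord 2) -> forall i, P i.
Proof.
move=> P0 P1 P2 [[|[|[|//]]] Hi].
- by have -> : Ordinal Hi = inord 0 by apply/val_inj; rewrite /= inordK.
- by have -> : Ordinal Hi = inord 1 by apply/val_inj; rewrite /= inordK.
- by have -> : Ordinal Hi = inord 2 by apply/val_inj; rewrite /= inordK.
Qed.

Lemma jmx_herm X : cmx_star (jmx X) = jmx X.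
Proof.
move: X => [[[[[u v] w] x] y] z].
apply/matrixP => i j; move: i; apply: ord3E; move: j; apply: ord3E;
  rewrite !mxE /= ?inordK //=.
all: by rewrite ?oppr0 ?cconjK.
Qed.

Lemma jmxP (M : 'M[cayley A]_3) :
  (2 : A) != 0 -> cmx_star M = M -> jmx (jcoord M) = M.
Proof.
move=> two0 HM.
have E i j : cconj (M j i) = M i j by rewrite -{2}HM mxE.
have self (c : A) : - c = c -> c = 0.
  move=> Hc; apply/eqP; have : (2 : A) * c == 0.
    by rewrite mulr_natl mulr2n -{1}Hc addNr.
  by rewrite mulf_eq0 (negPf two0).
have diag i : scal_cayley (cayley_re (M i i)) = M i i.
  move: (E i i); case: (M i i) => [[[[a b] c] d] [[[e f] g] h]].
  by rewrite /scal_cayley /quat_cayley /= =>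
    -[/self-> /self-> /self-> /self-> /self-> /self-> /self->].
apply/matrixP => i j; move: i; apply: ord3E; move: j; apply: ord3E;
  rewrite !mxE /= ?inordK //=.
all: by first [exact: diag | rewrite ?E].
Qed.

Lemma cconj_mul (x y : cayley A) : cconj (cmul x y) = cmul (cconj y) (cconj x).
Proof.
move: x y => [[[[a b] c] d] [[[e f] g] h]]
  [[[[a' b'] c'] d'] [[[e' f'] g'] h']].
rewrite /cconj /cmul /qmul /qconj /=.
by congr ((_, _, _, _), (_, _, _, _)); rewrite /=; ring.
Qed.

Lemma cconjD (x y : cayley A) : cconj (x + y) = cconj x + cconj y.
Proof.
move: x y => [[[[a b] c] d] n] [[[[a' b'] c'] d'] n'].
by rewrite /cconj /qconj /=; congr ((_, _, _, _), _); rewrite /= opprD.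
Qed.

Lemma cconjZ (k : A) (x : cayley A) : cconj (k *: x) = k *: cconj x.
Proof.
move: x => [[[[a b] c] d] n].
by rewrite /cconj /qconj /=; congr ((_, _, _, _), _); rewrite /= scalerN.
Qed.

Lemma jmx_jcirc X Y : (2 : A) != 0 ->
  jmx (jcirc X Y) = cmx_scale 2^-1
    (cmx_mul (jmx X) (jmx Y) + cmx_mul (jmx Y) (jmx X)).
Proof.
move=> two0; apply: jmxP => //.
apply/matrixP => i j; rewrite !mxE cconjZ cconjD addrC; congr (_ *: (_ + _)).
- rewrite (big_morph (@cconj A) cconjD (_ : cconj 0 = 0)); last first.
    by rewrite /cconj /= !oppr0.
  apply: eq_bigr => k _; rewrite cconj_mul.
  by rewrite -{2}(jmx_herm X) -{2}(jmx_herm Y) !mxE.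
- rewrite (big_morph (@cconj A) cconjD (_ : cconj 0 = 0)); last first.
    by rewrite /cconj /= !oppr0.
  apply: eq_bigr => k _; rewrite cconj_mul.
  by rewrite -{2}(jmx_herm X) -{2}(jmx_herm Y) !mxE.
Qed.

End JordanMatrix.

Section CoordinatewiseMaps.
Variables (A B : fieldType) (f : A -> B).

Definition quat_map (q : quat A) : quat B :=
  let: (a, b, c, d) := q in (f a, f b, f c, f d).

Definition cayley_map (x : cayley A) : cayley B :=
  (quat_map x.1, quat_map x.2).

Definition jordan_map (X : jordan A) : jordan B :=
  let: (xi1, xi2, xi3, x1, x2, x3) := X in
  (f xi1, f xi2, f xi3, cayley_map x1, cayley_map x2, cayley_map x3).

End CoordinatewiseMaps.

(* Iso_K(V), with (x * y)%g the composite map v |-> x (y v). *)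
Section LinearIsomorphisms.
Variables (K : fieldType) (V : lmodType K).

Record lin_iso := LinIso {
  lin_iso_fun :> V -> V;
  lin_iso_linear : linear lin_iso_fun;
  lin_iso_bij : bijective lin_iso_fun }.

HB.instance Definition _ := gen_eqMixin lin_iso.
HB.instance Definition _ := gen_choiceMixin lin_iso.

Lemma lin_iso_eq (x y : lin_iso) : x =1 y -> x = y.
Proof.
case: x y => [x xl xb] [y yl yb] /= /funext E; subst y.
by congr LinIso; exact: Prop_irrelevance.
Qed.

Lemma lin_iso1_subproof : linear (@idfun V) /\ bijective (@idfun V).
Proof. by split => //; exists idfun. Qed.

Definition lin_iso1 : lin_iso :=
  LinIso lin_iso1_subproof.1 lin_iso1_subproof.2.

Lemma lin_isoM_subproof (x y : lin_iso) : linear (x \o y).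
Proof. by move=> k u v /=; rewrite !lin_iso_linear. Qed.

Definition lin_isoM (x y : lin_iso) : lin_iso :=
  LinIso (@lin_isoM_subproof x y) (bij_comp (lin_iso_bij x) (lin_iso_bij y)).

Lemma lin_isoV_subproof (x : lin_iso) :
  exists y : lin_iso, cancel x y /\ cancel y x.
Proof.
case: (lin_iso_bij x) => g xK gK.
have lg : linear g.
  by move=> k u v; apply: (can_inj xK); rewrite lin_iso_linear !gK.
by exists (LinIso lg (Bijective gK xK)).
Qed.

Definition lin_isoV (x : lin_iso) : lin_iso := projT1 (cid (lin_isoV_subproof x)).

Lemma lin_isoK (x : lin_iso) : cancel x (lin_isoV x).
Proof. by rewrite /lin_isoV; case: cid => y []. Qed.

Lemma lin_isoVK (x : lin_iso) : cancel (lin_isoV x) x.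
Proof. by rewrite /lin_isoV; case: cid => y []. Qed.

Lemma lin_isoA : associative lin_isoM. Proof. by move=> x y z; exact: lin_iso_eq. Qed.
Lemma lin_iso1M : left_id lin_iso1 lin_isoM. Proof. by move=> x; exact: lin_iso_eq. Qed.
Lemma lin_isoM1 : right_id lin_iso1 lin_isoM. Proof. by move=> x; exact: lin_iso_eq. Qed.
Lemma lin_isoVM : left_inverse lin_iso1 lin_isoV lin_isoM.
Proof. by move=> x; apply: lin_iso_eq => v; exact: lin_isoK. Qed.
Lemma lin_isoMV : right_inverse lin_iso1 lin_isoV lin_isoM.
Proof. by move=> x; apply: lin_iso_eq => v; exact: lin_isoVK. Qed.

HB.instance Definition _ :=
  isGroup.Build lin_iso lin_isoA lin_iso1M lin_isoM1 lin_isoVM lin_isoMV.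

End LinearIsomorphisms.

(* The topology of pointwise convergence; for a finite-dimensional V it is the
   usual topology of the general linear group. *)
HB.instance Definition _ (K : numFieldType) (V : normedModType K) :=
  Topological.copy (lin_iso V)
    (initial_topology (fun x : lin_iso V => (x : {ptws V -> V}))).

Section Subgroups.
Variable G : groupType.
Implicit Types A B H N : set G.
Local Open Scope group_scope.

Definition subgroup H : Prop :=
  [/\ H 1, forall x y, H x -> H y -> H (x * y) & forall x, H x -> H x^-1].

Definition normal_subgroup N H : Prop :=
  [/\ subgroup H, subgroup N, N `<=` H &
      forall x n, H x -> N n -> N (x * n * x^-1)].

Definition setmul A B : set G := [set x * y | x in A & y in B].

(* The subgroup [setmul A B] is the internal direct product of A and B. *)
Definition direct_subgroups A B : Prop :=
  [/\ subgroup A, subgroup B, forall x y, A x -> B y -> x * y = y * x &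
      A `&` B = [set 1]].

Definition coset_by N (x : G) : set G := [set x * n | n in N].

(* The underlying set of H / N; the product of two cosets is their [setmul]. *)
Definition cosets H N : set (set G) := [set coset_by N x | x in H].

End Subgroups.

Definition quotient_isomorphism (T L : groupType) (G N : set T) (H : set L)
    (f : set T -> L) : Prop :=
  set_bij (cosets G N) H f /\
  (forall A B, cosets G N A -> cosets G N B ->
     f (setmul A B) = (f A * f B)%g).

(* p : G -> H, a composite G -> G / N -> H of the canonical projection with a
   bijection f, is a quotient map for the topologies that G and H inherit from
   T and L: this says that f is a homeomorphism for the quotient topology on
   G / N. *)
Definition topological_quotient_map (T L : topologicalType) (G : set T)
    (H : set L) (p : T -> L) : Prop :=
  forall V : set L,
    open (V : set (subspace H)) <-> open (p @^-1` V : set (subspace G)).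

Section UnitCircles.
Variable R : realType.

Record U1 := MkU1 { U1_val :> R[i]; U1P : conjc U1_val * U1_val == 1 }.

HB.instance Definition _ := [isSub for U1_val].
HB.instance Definition _ := [Choice of U1 by <:].
HB.instance Definition _ :=
  Topological.copy U1 (initial_topology (U1_val : U1 -> R[i]^o)).

Definition U1_one : U1 := @MkU1 1 (introT eqP (etrans (mulr1 _) (rmorph1 _))).

Lemma U1_mul_subproof (x y : U1) : conjc ((x : R[i]) * y) * ((x : R[i]) * y) == 1.
Proof.
by rewrite rmorphM mulrACA (eqP (U1P x)) (eqP (U1P y)) mulr1.
Qed.
Definition U1_mul (x y : U1) : U1 := MkU1 (U1_mul_subproof x y).

Lemma U1_inv_subproof (x : U1) : conjc (conjc x) * conjc x == 1.
Proof. by rewrite conjcK mulrC (eqP (U1P x)). Qed.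
Definition U1_inv (x : U1) : U1 := MkU1 (U1_inv_subproof x).

Lemma U1_mulA : associative U1_mul.
Proof. by move=> x y z; apply/val_inj; exact: mulrA. Qed.
Lemma U1_mul1 : left_id U1_one U1_mul.
Proof. by move=> x; apply/val_inj; exact: mul1r. Qed.
Lemma U1_mulr1 : right_id U1_one U1_mul.
Proof. by move=> x; apply/val_inj; exact: mulr1. Qed.
Lemma U1_mulV : left_inverse U1_one U1_inv U1_mul.
Proof. by move=> x; apply/val_inj/eqP; exact: U1P. Qed.
Lemma U1_mulrV : right_inverse U1_one U1_inv U1_mul.
Proof. by move=> x; apply/val_inj; rewrite /= mulrC; apply/eqP/U1P. Qed.
HB.instance Definition _ :=
  isGroup.Build U1 U1_mulA U1_mul1 U1_mulr1 U1_mulV U1_mulrV.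

Lemma U1_opp_subproof (x : U1) : conjc (- (x : R[i])) * - (x : R[i]) == 1.
Proof. by rewrite rmorphN mulrNN U1P. Qed.
Definition U1_opp (x : U1) : U1 := MkU1 (U1_opp_subproof x).

Lemma U1_expi_subproof (t : R) :
  conjc (cos t +i* sin t) * (cos t +i* sin t) == 1.
Proof.
apply/eqP; rewrite -[LHS]/(Complex _ _); congr Complex; last by ring.
by rewrite mulNr opprK -!expr2 cos2Dsin2.
Qed.

(* exp(i t), by Euler's formula. *)
Definition U1_expi (t : R) : U1 := MkU1 (U1_expi_subproof t).

Lemma U1_i_subproof : conjc ('i : R[i]) * 'i == 1.
Proof.
by apply/eqP; rewrite -[LHS]/(Complex _ _); congr Complex; ring.
Qed.
Definition U1_i : U1 := MkU1 U1_i_subproof.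

Definition bold_C : set (quat R) :=
  [set q | exists x y : R, q = (x, y, 0, 0)].

Definition qnorm (q : quat R) : R :=
  let: (a, b, c, d) := q in Num.sqrt (a ^+ 2 + b ^+ 2 + c ^+ 2 + d ^+ 2).

Record unit_C := MkUnitC {
  unit_C_val :> quat R;
  unit_CP : bold_C unit_C_val;
  unit_C_norm : qnorm unit_C_val = 1 }.

Lemma unit_C_subproof (x y : R) (h : x ^+ 2 + y ^+ 2 = 1) :
  bold_C (x, y, 0, 0) /\ qnorm (x, y, 0, 0) = 1.
Proof.
split; first by exists x, y.
by rewrite /qnorm /= expr0n /= !addr0 h sqrtr1.
Qed.

Definition mk_unit_C (x y : R) (h : x ^+ 2 + y ^+ 2 = 1) : unit_C :=
  MkUnitC (unit_C_subproof h).1 (unit_C_subproof h).2.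

Lemma e1_subproof : 0 ^+ 2 + 1 ^+ 2 = 1 :> R. Proof. by ring. Qed.
Lemma Ne1_subproof : 0 ^+ 2 + (- 1) ^+ 2 = 1 :> R. Proof. by ring. Qed.
Lemma N1_subproof : (- 1) ^+ 2 + 0 ^+ 2 = 1 :> R. Proof. by ring. Qed.
Lemma omega_subproof :
  (- (1 / 2)) ^+ 2 + (Num.sqrt 3 / 2) ^+ 2 = 1 :> R.
Proof. by rewrite expr_div_n sqr_sqrtr ?ler0n //; field. Qed.

Definition unit_e1 : unit_C := mk_unit_C e1_subproof.
Definition unit_Ne1 : unit_C := mk_unit_C Ne1_subproof.
Definition unit_N1 : unit_C := mk_unit_C N1_subproof.
Definition unit_omega : unit_C := mk_unit_C omega_subproof.

End UnitCircles.

Section CayleyBilinear.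
Variable A : fieldType.

Lemma cmulDl (u v y : cayley A) : cmul (u + v) y = cmul u y + cmul v y.
Proof.
move: u y v => [[[[a b] c] d] [[[e f] g] h]]
  [[[[a' b'] c'] d'] [[[e' f'] g'] h']]
  [[[[a'' b''] c''] d''] [[[e'' f''] g''] h'']].
rewrite /cmul /qmul /qconj /=.
by congr ((_, _, _, _), (_, _, _, _)); rewrite /GRing.scale /=; ring.
Qed.

Lemma cmulDr (u v y : cayley A) : cmul y (u + v) = cmul y u + cmul y v.
Proof.
move: u y v => [[[[a b] c] d] [[[e f] g] h]]
  [[[[a' b'] c'] d'] [[[e' f'] g'] h']]
  [[[[a'' b''] c''] d''] [[[e'' f''] g''] h'']].
rewrite /cmul /qmul /qconj /=.
by congr ((_, _, _, _), (_, _, _, _)); rewrite /GRing.scale /=; ring.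
Qed.

Lemma cmulZl (k : A) (u y : cayley A) : cmul (k *: u) y = k *: cmul u y.
Proof.
move: u y => [[[[a b] c] d] [[[e f] g] h]]
  [[[[a' b'] c'] d'] [[[e' f'] g'] h']].
rewrite /cmul /qmul /qconj /=.
by congr ((_, _, _, _), (_, _, _, _)); rewrite /GRing.scale /=; ring.
Qed.

Lemma cmulZr (k : A) (u y : cayley A) : cmul y (k *: u) = k *: cmul y u.
Proof.
move: u y => [[[[a b] c] d] [[[e f] g] h]]
  [[[[a' b'] c'] d'] [[[e' f'] g'] h']].
rewrite /cmul /qmul /qconj /=.
by congr ((_, _, _, _), (_, _, _, _)); rewrite /GRing.scale /=; ring.
Qed.

End CayleyBilinear.

Section ComplexJordan.
Variable R : realType.
Local Notation C := R[i].
Local Notation JC := (jordan C).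

Definition jtau : JC -> JC := jordan_map (@conjc R).

Definition jherm (X Y : JC) : C := jdot (jtau X) Y.

Definition E6 : set (lin_iso JC) := [set alpha |
  (forall X, jdet (alpha X) = jdet X) /\
  (forall X Y, jherm (alpha X) (alpha Y) = jherm X Y)].

Definition E6_fix (g : lin_iso JC) : set (lin_iso JC) :=
  [set alpha | E6 alpha /\ (g^-1 * alpha * g = alpha)%g].

(* The C-linear extension to J + iJ of a map of J. *)
Definition cext (f : jordan R -> jordan R) (Z : JC) : JC :=
  jordan_map (real_complex R) (f (jordan_map (@complex.Re R) Z))
  + ('i : C) *: jordan_map (real_complex R) (f (jordan_map (@complex.Im R) Z)).

(* Only the flexible law is needed for the bracketing of conj(a) x1 conj(a) to
   be irrelevant. *)
Definition dmap (a : quat R) (X : jordan R) : jordan R :=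
  let: (xi1, xi2, xi3, x1, x2, x3) := X in
  let b := quat_cayley a in
  (xi1, xi2, xi3,
   cmul (cmul (cconj b) x1) (cconj b), cmul b x2, cmul x3 b).

Definition phi_map (theta : U1 R) (X : JC) : JC :=
  let: (xi1, xi2, xi3, x1, x2, x3) := X in
  let t : C := theta in
  (t ^+ 4 * xi1, t ^- 2 * xi2, t ^- 2 * xi3,
   t ^- 2 *: x1, t *: x2, t *: x3).

Local Notation re := (@complex.Re R).
Local Notation im := (@complex.Im R).
Local Notation rc := (real_complex R).

Lemma rcDi_subproof (x y : R) : x%:C + 'i * y%:C = x +i* y.
Proof. by rewrite -[LHS]/(Complex _ _) /=; congr Complex; ring. Qed.

Lemma jordan_rcDi (X Y : jordan R) :
  jordan_map rc X + ('i : C) *: jordan_map rc Y =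
  let q p p' := (p.1.1.1 +i* p'.1.1.1, p.1.1.2 +i* p'.1.1.2,
                 p.1.2 +i* p'.1.2, p.2 +i* p'.2) in
  let c (x x' : cayley R) := (q x.1 x'.1, q x.2 x'.2) in
  let: (u, v, w, x, y, z) := X in let: (u', v', w', x', y', z') := Y in
  (u +i* u', v +i* v', w +i* w', c x x', c y y', c z z').
Proof.
move: X Y => [[[[[? ?] ?] [[[[? ?] ?] ?] [[[? ?] ?] ?]]] [[[[? ?] ?] ?] [[[? ?] ?] ?]]]
  [[[[? ?] ?] ?] [[[? ?] ?] ?]]].
move=> [[[[[? ?] ?] [[[[? ?] ?] ?] [[[? ?] ?] ?]]] [[[[? ?] ?] ?] [[[? ?] ?] ?]]]
  [[[[? ?] ?] ?] [[[? ?] ?] ?]]].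
by rewrite /= /cayley_map /= -!rcDi_subproof.
Qed.

Lemma jordan_ReIm (Z : JC) :
  jordan_map rc (jordan_map re Z) + ('i : C) *: jordan_map rc (jordan_map im Z)
  = Z.
Proof.
rewrite jordan_rcDi.
by move: Z => [[[[[[? ?] [? ?]] [? ?]]
  [[[[[? ?] [? ?]] [? ?]] [? ?]] [[[[? ?] [? ?]] [? ?]] [? ?]]]]
  [[[[[? ?] [? ?]] [? ?]] [? ?]] [[[[? ?] [? ?]] [? ?]] [? ?]]]]
  [[[[[? ?] [? ?]] [? ?]] [? ?]] [[[[? ?] [? ?]] [? ?]] [? ?]]]].
Qed.

Lemma jordan_re (X Y : jordan R) :
  jordan_map re (jordan_map rc X + ('i : C) *: jordan_map rc Y) = X.
Proof.
rewrite jordan_rcDi; move: X Y => [[[[[? ?] ?] [[[[? ?] ?] ?] [[[? ?] ?] ?]]] [[[[? ?] ?] ?] [[[? ?] ?] ?]]]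
  [[[[? ?] ?] ?] [[[? ?] ?] ?]]].
by move=> [[[[[? ?] ?] ?] ?] ?].
Qed.

Lemma jordan_im (X Y : jordan R) :
  jordan_map im (jordan_map rc X + ('i : C) *: jordan_map rc Y) = Y.
Proof.
rewrite jordan_rcDi; move: X Y => [[[[[? ?] ?] ?] ?] ?].
by move=> [[[[[? ?] ?] [[[[? ?] ?] ?] [[[? ?] ?] ?]]] [[[[? ?] ?] ?] [[[? ?] ?] ?]]]
  [[[[? ?] ?] ?] [[[? ?] ?] ?]]].
Qed.

Lemma jordan_map_rcD (X Y : jordan R) :
  jordan_map rc (X + Y) = jordan_map rc X + jordan_map rc Y.
Proof.
move: X Y => [[[[[? ?] ?] [[[[? ?] ?] ?] [[[? ?] ?] ?]]] [[[[? ?] ?] ?] [[[? ?] ?] ?]]]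
  [[[[? ?] ?] ?] [[[? ?] ?] ?]]].
move=> [[[[[? ?] ?] [[[[? ?] ?] ?] [[[? ?] ?] ?]]] [[[[? ?] ?] ?] [[[? ?] ?] ?]]]
  [[[[? ?] ?] ?] [[[? ?] ?] ?]]].
by rewrite /= /cayley_map /= !rmorphD.
Qed.

Lemma jordan_map_rcZ (k : R) (X : jordan R) :
  jordan_map rc (k *: X) = k%:C *: jordan_map rc X.
Proof.
move: X => [[[[[? ?] ?] [[[[? ?] ?] ?] [[[? ?] ?] ?]]] [[[[? ?] ?] ?] [[[? ?] ?] ?]]]
  [[[[? ?] ?] ?] [[[? ?] ?] ?]]].
by rewrite /= /cayley_map /= !rmorphM.
Qed.

Lemma cext_cancel f g : cancel f g -> cancel (cext f) (cext g).
Proof.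
by move=> fK Z; rewrite {1}/cext jordan_re jordan_im !fK jordan_ReIm.
Qed.

Lemma cextE f (X Y : jordan R) :
  cext f (jordan_map rc X + ('i : C) *: jordan_map rc Y) =
  jordan_map rc (f X) + ('i : C) *: jordan_map rc (f Y).
Proof. by rewrite /cext jordan_re jordan_im. Qed.

Lemma cext_linear f : linear f -> linear (cext f).
Proof.
move=> fl [r s] U V.
have fD X Y : f (X + Y) = f X + f Y.
  by rewrite -[X in X + Y]scale1r fl scale1r.
have f0 : f 0 = 0 by apply: (addrI (f 0)); rewrite -fD !addr0.
have fZ k X : f (k *: X) = k *: f X by rewrite -[k *: X]addr0 fl f0 addr0.
rewrite -{1}(jordan_ReIm U) -{1}(jordan_ReIm V) {2 3}/cext.
move: (jordan_map re U) (jordan_map im U) => X Y.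
move: (jordan_map re V) (jordan_map im V) => X' Y'.
have -> : r +i* s = r%:C + 'i * s%:C by rewrite rcDi_subproof.
have E (P Q P' Q' : jordan R) :
    (r%:C + 'i * s%:C) *: (jordan_map rc P + ('i : C) *: jordan_map rc Q)
      + (jordan_map rc P' + ('i : C) *: jordan_map rc Q')
    = jordan_map rc (r *: P + ((- s) *: Q + P'))
      + ('i : C) *: jordan_map rc (r *: Q + (s *: P + Q')).
  rewrite !jordan_map_rcD !jordan_map_rcZ rmorphN !scalerDl !scalerDr.
  rewrite !scalerA (mulrC r%:C 'i) (_ : 'i * s%:C * 'i = - s%:C); last first.
    by rewrite -[LHS]/(Complex _ _) -[RHS]/(Complex _ _) /=; congr Complex; ring.
  by rewrite [LHS](AC ((2*2)*2) ((1*(4*5))*(2*(3*6)))).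
by rewrite E cextE !fD !fZ -E.
Qed.

Lemma dmap_linear a : linear (dmap a).
Proof.
move=> k [[[[[u v] w] x] y] z] [[[[[u' v'] w'] x'] y'] z'].
rewrite /dmap; set b := quat_cayley a.
transitivity (k * u + u', k * v + v', k * w + w',
  cmul (cmul (cconj b) (k *: x + x')) (cconj b),
  cmul b (k *: y + y'), cmul (k *: z + z') b) => //.
by rewrite !(cmulDl, cmulDr, cmulZl, cmulZr).
Qed.

Lemma dmap_cancel (x y : R) : x ^+ 2 + y ^+ 2 = 1 ->
  cancel (dmap (x, y, 0, 0)) (dmap (x, - y, 0, 0)).
Proof.
move=> xy1.
have E1 (c : cayley R) : let b := quat_cayley (x, y, 0, 0) in
    let b' := quat_cayley (x, - y, 0, 0) in
    [/\ cmul b' (cmul b c) = c, cmul b (cmul b' c) = c,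
        cmul (cmul c b) b' = c & cmul (cmul c b') b = c].
  move: c => [[[[c0 c1] c2] c3] [[[c4 c5] c6] c7]] /=.
  have E (c : R) : (x ^+ 2 + y ^+ 2) * c = c by rewrite xy1 mul1r.
  by split; congr ((_, _, _, _), (_, _, _, _)); rewrite /= -[RHS]E; ring.
have flex (q : quat R) (c : cayley R) : let b := quat_cayley q in
    cmul (cmul b c) b = cmul b (cmul c b).
  move: q c => [[[q0 q1] q2] q3] [[[[c0 c1] c2] c3] [[[c4 c5] c6] c7]] /=.
  by congr ((_, _, _, _), (_, _, _, _)); rewrite /=; ring.
have conjb (t : R) :
    cconj (quat_cayley (x, t, 0, 0)) = quat_cayley (x, - t, 0, 0).
  by rewrite /cconj /quat_cayley /= !oppr0.
have E2 (c : cayley R) : let b := quat_cayley (x, y, 0, 0) in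
    let b' := quat_cayley (x, - y, 0, 0) in
    cmul (cmul b (cmul (cmul b' c) b')) b = c.
  move=> b b'; rewrite [cmul (cmul b' c) b']flex.
  have [_ -> _ _] := E1 (cmul c b').
  by have [] := E1 c.
move=> [[[[[u v] w] x1] x2] x3]; rewrite /dmap.
have [-> _ _ _] := E1 x2; have [_ _ -> _] := E1 x3.
by rewrite !conjb opprK E2.
Qed.

Lemma dmap_bij (a : unit_C R) : bijective (dmap a).
Proof.
have [x [y axy]] := unit_CP a; have := unit_C_norm a; rewrite axy => h.
have xy1 : x ^+ 2 + y ^+ 2 = 1.
  move: h; rewrite /qnorm expr0n /= !addr0 => h.
  by rewrite -[LHS]sqr_sqrtr ?addr_ge0 ?sqr_ge0 // h expr1n.
exists (dmap (x, - y, 0, 0)); first exact: dmap_cancel.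
by rewrite -{2}[y]opprK; apply: dmap_cancel; rewrite sqrrN.
Qed.

Lemma cext_dmap_bij (a : unit_C R) : bijective (cext (dmap a)).
Proof.
by case: (dmap_bij a) => g fK gK; exists (cext g); exact: cext_cancel.
Qed.

Definition D_iso (a : unit_C R) : lin_iso JC :=
  LinIso (cext_linear (dmap_linear a)) (cext_dmap_bij a).

Lemma phi_map_linear theta : linear (phi_map theta).
Proof.
move=> k [[[[[u v] w] x] y] z] [[[[[u' v'] w'] x'] y'] z'].
rewrite /phi_map; set t : C := theta.
have E (m : C) (V : lmodType C) (p q : V) :
    m *: (k *: p + q) = k *: (m *: p) + m *: q.
  by rewrite scalerDr !scalerA mulrC.
have F (m p q : C) : m * (k * p + q) = k * (m * p) + m * q by ring.
transitivity (t ^+ 4 * (k * u + u'), t ^- 2 * (k * v + v'),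
  t ^- 2 * (k * w + w'), t ^- 2 *: (k *: x + x'), t *: (k *: y + y'),
  t *: (k *: z + z')) => //.
by congr (_, _, _, _, _, _); [exact: F | exact: F | exact: F | exact: E
  | exact: E | exact: E].
Qed.

Lemma phi_map_bij theta : bijective (phi_map theta).
Proof.
have K (x : U1 R) : cancel (phi_map x) (phi_map (U1_inv x)).
  have x0 : (x : C) != 0.
    apply/eqP => x0; have := U1P x; rewrite x0 mulr0 eq_sym.
    by rewrite (negPf (oner_neq0 _)).
  have xV : (U1_inv x : C) = (x : C)^-1.
    by apply: (mulIf x0); rewrite mulVf //; apply/eqP/U1P.
  move=> [[[[[u v] w] a] b] c]; rewrite /phi_map xV.
  have L (m p : C) n : m != 0 -> m^-1 ^+ n * (m ^+ n * p) = p.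
    by move=> m0; rewrite mulrA -exprMn mulVf // expr1n mul1r.
  have L' (p : C) n : (x : C)^-1 ^- n * ((x : C) ^- n * p) = p.
    by rewrite -!exprVn L // invr_eq0.
  have L1 : (x : C)^-1 ^- 2 * (x : C) ^- 2 = 1 by rewrite -[RHS](L' 1 2) mulr1.
  by rewrite L // !L' !scalerA L1 mulVf // !scale1r.
exists (phi_map (U1_inv theta)) => //.
rewrite -{2}(_ : U1_inv (U1_inv theta) = theta); first exact: K.
by apply/val_inj; exact: conjcK.
Qed.

Definition phi_iso (theta : U1 R) : lin_iso JC :=
  LinIso (phi_map_linear theta) (phi_map_bij theta).

Definition sigma : lin_iso JC := D_iso (unit_N1 R).
Definition sigma3 : lin_iso JC := D_iso (unit_omega R).
Definition mu3 : lin_iso JC := phi_iso (U1_expi (2 * pi / 9)).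

Definition Spin2 : set (lin_iso JC) := range D_iso.

Definition Spin8 : set (lin_iso JC) := [set alpha |
  [/\ E6 alpha, alpha (jE1 C) = jE1 C,
      alpha (jF1 (scal_cayley 1)) = jF1 (scal_cayley 1) &
      alpha (jF1 (cayley_e1 C)) = jF1 (cayley_e1 C)]].

Definition U1_Spin2_Spin8 : set (U1 R * lin_iso JC * lin_iso JC) :=
  [set: U1 R] `*` Spin2 `*` Spin8.

Definition group_Z2 : set (U1 R * lin_iso JC * lin_iso JC) :=
  [set (1, 1, 1)%g; (1%g, sigma, sigma)].

Definition group_Z4 : set (U1 R * lin_iso JC * lin_iso JC) :=
  [set (1, 1, 1)%g;
       (U1_i R, D_iso (unit_e1 R),
        phi_iso (U1_opp (U1_i R)) * D_iso (unit_Ne1 R))%g;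
       (U1_opp 1%g, sigma, 1%g);
       (U1_opp (U1_i R), D_iso (unit_Ne1 R),
        phi_iso (U1_i R) * D_iso (unit_e1 R))%g].

End ComplexJordan.

(* Main.v *)
(* Write x for the cross product of the Jordan algebra. An element of E6 satisfies
   [f X x f Y = tau f tau (X x Y)]. Expressing phi(theta) and D_a by the product
   and by E1, F1(1), F1(e1) shows that U(1), Spin(2) and Spin(8) commute pairwise,
   so that (theta, D, b) |-> phi(theta) D b is a homomorphism into the
   centralizer of sigma3.

   Conversely, if f commutes with sigma3, then f E1 = u E1 because f E1 is a
   sigma3-fixed element with f E1 x f E1 = 0. So f preserves the Peirce space
   {xi2, xi3, x1}, where sigma3 has the eigenvectors F1(1 + i e1) and
   F1(1 - i e1) for distinct eigenvalues; f multiplies them by l and m with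
   u l m = 1. If theta^4 = u and z^2 = theta^2 l, then D_z^-1 phi(theta)^-1 f fixes
   E1, F1(1), F1(e1), that is, it is in Spin(8). The image thus is the whole
   centralizer, and all of it commutes with mu3 = phi(nu). The kernel consists of
   the triples with theta^4 = 1, z^2 = theta^2 and b = (phi(theta) D_z)^-1. Since theta and z can be chosen
   locally continuously in f, the homomorphism is a quotient map. *)

Require Import Defs.
From HB Require Import structures.
From mathcomp Require Import all_boot all_order all_algebra.
From mathcomp Require Import all_classical all_reals all_analysis.
From mathcomp Require Import complex ring.

Set Implicit Arguments.
Unset Strict Implicit.
Unset Printing Implicit Defensive.

Import Order.TTheory GRing.Theory Num.Theory.
Import numFieldNormedType.Exports.

Local Open Scope classical_set_scope.
Local Open Scope ring_scope.

(** * Coordinate formulas and the cubic form *)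

Section JordanFormulas.
Variable A : fieldType.
Hypothesis two0 : (2 : A) != 0.

Definition cdot (x y : cayley A) : A :=
  x.1.1.1.1 * y.1.1.1.1 + x.1.1.1.2 * y.1.1.1.2 + x.1.1.2 * y.1.1.2
  + x.1.2 * y.1.2 + x.2.1.1.1 * y.2.1.1.1 + x.2.1.1.2 * y.2.1.1.2
  + x.2.1.2 * y.2.1.2 + x.2.2 * y.2.2.

Lemma cdotC x y : cdot x y = cdot y x.
Proof. by rewrite /cdot; ring. Qed.

Lemma cdotDl x y z : cdot (x + y) z = cdot x z + cdot y z.
Proof. by rewrite /cdot /=; ring. Qed.

Lemma cdotZl k x z : cdot (k *: x) z = k * cdot x z.
Proof. by rewrite /cdot /GRing.scale /= /GRing.scale /=; ring. Qed.

Lemma cdot_conj_cmulC x y z :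
  cdot (cconj (cmul x y)) z = cdot (cconj (cmul y z)) x.
Proof.
move: x y z => [[[[a b] c] d] [[[e f] g] h]]
  [[[[a' b'] c'] d'] [[[e' f'] g'] h']]
  [[[[a'' b''] c''] d''] [[[e'' f''] g''] h'']].
by rewrite /cdot /=; ring.
Qed.

Lemma jordanP (X Y : jordan A) :
  X.1.1.1.1.1 = Y.1.1.1.1.1 -> X.1.1.1.1.2 = Y.1.1.1.1.2 ->
  X.1.1.1.2 = Y.1.1.1.2 -> X.1.1.2 = Y.1.1.2 -> X.1.2 = Y.1.2 ->
  X.2 = Y.2 -> X = Y.
Proof.
move: X Y => [[[[[u v] w] x] y] z] [[[[[u' v'] w'] x'] y'] z'] /=.
by move=> -> -> -> -> -> ->.
Qed.

Lemma cayleyP (x y : cayley A) :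
  x.1.1.1.1 = y.1.1.1.1 -> x.1.1.1.2 = y.1.1.1.2 -> x.1.1.2 = y.1.1.2 ->
  x.1.2 = y.1.2 -> x.2.1.1.1 = y.2.1.1.1 -> x.2.1.1.2 = y.2.1.1.2 ->
  x.2.1.2 = y.2.1.2 -> x.2.2 = y.2.2 -> x = y.
Proof.
move: x y => [[[[a b] c] d] [[[e f] g] h]]
  [[[[a' b'] c'] d'] [[[e' f'] g'] h']] /=.
by move=> -> -> -> -> -> -> -> ->.
Qed.

Lemma cmul_scall (k : A) (x : cayley A) : cmul (scal_cayley k) x = k *: x.
Proof.
move: x => [[[[a b] c] d] [[[e f] g] h]].
by apply: cayleyP; rewrite /= /GRing.scale /=; ring.
Qed.

Lemma cmul_scalr (k : A) (x : cayley A) : cmul x (scal_cayley k) = k *: x.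
Proof.
move: x => [[[[a b] c] d] [[[e f] g] h]].
by apply: cayleyP; rewrite /= /GRing.scale /=; ring.
Qed.

Lemma re_cmul_conjr (x y : cayley A) : cayley_re (cmul x (cconj y)) = cdot x y.
Proof.
move: x y => [[[[a b] c] d] [[[e f] g] h]]
  [[[[a' b'] c'] d'] [[[e' f'] g'] h']].
by rewrite /cdot /cayley_re /=; ring.
Qed.

Lemma re_cmul_conjl (x y : cayley A) : cayley_re (cmul (cconj x) y) = cdot x y.
Proof.
move: x y => [[[[a b] c] d] [[[e f] g] h]]
  [[[[a' b'] c'] d'] [[[e' f'] g'] h']].
by rewrite /cdot /cayley_re /=; ring.
Qed.

Lemma cayley_re_scal (k : A) : cayley_re (scal_cayley k) = k.
Proof. by []. Qed.

Lemma cayley_reD (x y : cayley A) : cayley_re (x + y) = cayley_re x + cayley_re y.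
Proof. by []. Qed.

Lemma cayley_reZ (k : A) (x : cayley A) : cayley_re (k *: x) = k * cayley_re x.
Proof. by []. Qed.

Local Arguments cayley_re : simpl never.
Local Arguments cmul : simpl never.
Local Arguments cconj : simpl never.
Local Arguments scal_cayley : simpl never.

Lemma jcircE u v w x y z u' v' w' x' y' z' :
  jcirc (u, v, w, x, y, z) (u', v', w', x', y', z') =
  ((u * u' + cdot y y' + cdot z z',
    v * v' + cdot x x' + cdot z z',
    w * w' + cdot x x' + cdot y y',
    2^-1 *: (cconj (cmul y z' + cmul y' z) + (v + w) *: x' + (v' + w') *: x),
    2^-1 *: (cconj (cmul z x' + cmul z' x) + (u + w) *: y' + (u' + w') *: y),
    2^-1 *: (cconj (cmul x y' + cmul x' y) + (u + v) *: z' + (u' + v') *: z))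
    : jordan A).
Proof.
rewrite /jcirc /jcoord !mxE !big_ord_recl !big_ord0 !mxE /= !inordK //=.
rewrite !addr0 !(cayley_reZ, cayley_reD) !(cmul_scall, cmul_scalr) -!cconj_mul.
rewrite !re_cmul_conjr !re_cmul_conjl !cayley_reZ !cayley_re_scal !cconjD.
rewrite (cdotC x' x) (cdotC y' y) (cdotC z' z).
congr (_, _, _, _ *: _, _ *: _, _ *: _).
- by field.
- by field.
- by field.
- by rewrite !scalerDl [LHS](AC ((1*2)*(1*2)) ((4*1)*(2*6)*(5*3))).
- by rewrite !scalerDl [LHS](AC ((1*2)*(1*2)) ((5*2)*(4*3)*(1*6))).
- by rewrite !scalerDl [LHS](AC ((1*2)*(1*2)) ((6*3)*(1*5)*(4*2))).
Qed.

Lemma jdotE u v w x y z u' v' w' x' y' z' :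
  jdot (u, v, w, x, y, z) (u', v', w', x', y', z') =
  u * u' + v * v' + w * w' + 2 * (cdot x x' + cdot y y' + cdot z z').
Proof. by rewrite /jdot jcircE /jtr; ring. Qed.

Lemma jcrossE u v w x y z u' v' w' x' y' z' :
  jcross (u, v, w, x, y, z) (u', v', w', x', y', z') =
  2^-1 *: ((v * w' + w * v' - 2 * cdot x x',
    u * w' + w * u' - 2 * cdot y y',
    u * v' + v * u' - 2 * cdot z z',
    cconj (cmul y z' + cmul y' z) - u *: x' - u' *: x,
    cconj (cmul z x' + cmul z' x) - v *: y' - v' *: y,
    cconj (cmul x y' + cmul x' y) - w *: z' - w' *: z) : jordan A).
Proof.
rewrite /jcross jdotE jcircE /jtr; congr (_ *: _).
have E (p q r p' q' r' m : A) (c x1 x2 : cayley A) :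
    2 *: (2^-1 *: (c + (q + r) *: x1 + (q' + r') *: x2))
    - (p + q + r) *: x1 - (p' + q' + r') *: x2 + m *: 0
    = c - p *: x1 - p' *: x2.
  rewrite scaler0 addr0 scalerA mulfV // scale1r.
  rewrite -(addrA p) -(addrA p') (scalerDl _ p) (scalerDl _ p').
  by rewrite !opprD [LHS](AC (3*2*2) (1*4*6*(2*5)*(3*7))) /= !subrr !addr0.
apply: jordanP.
1-3: by rewrite /= /GRing.scale /=; ring.
- exact: E.
- by rewrite /= (addrC u v) (addrC u' v'); exact: E.
- rewrite /= (addrC (u + v) w) (addrC (u' + v') w') !(addrA w) !(addrA w').
  exact: E.
Qed.

End JordanFormulas.

Local Open Scope complex_scope.
Local Opaque jcross jdot jcirc.

Section SymmetricTrilinear.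
Variables (K : fieldType) (V : lmodType K).
Variables (dot : V -> V -> K) (cross : V -> V -> V) (cube : V -> K).
Hypotheses (dotC : forall x y, dot x y = dot y x)
  (dotDr : forall x y z, dot x (y + z) = dot x y + dot x z)
  (dotZr : forall x k y, dot x (k *: y) = k * dot x y)
  (dot_inj : forall x y, (forall z, dot x z = dot y z) -> x = y)
  (crossC : forall x y, cross x y = cross y x)
  (dot_crossCr : forall x y z, dot (cross x y) z = dot (cross x z) y).

Lemma dot_crossCA x y z : dot (cross x y) z = dot (cross y z) x.
Proof. by rewrite crossC dot_crossCr. Qed.

Lemma symmetric_crossDl x y z : cross (x + y) z = cross x z + cross y z.
Proof.
apply: dot_inj => w; rewrite dot_crossCA dotDr [RHS]dotC dotDr !(dotC w).
by rewrite (dot_crossCA x) (dot_crossCA y).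
Qed.

Lemma symmetric_crossZl k x z : cross (k *: x) z = k *: cross x z.
Proof.
apply: dot_inj => w; rewrite dot_crossCA dotZr [RHS]dotC dotZr (dotC w).
by rewrite (dot_crossCA x).
Qed.

Hypothesis cubeE : forall x, 3 * cube x = dot (cross x x) x.

Lemma dot_cross_cube x y z : 6 * dot (cross x y) z =
  3 * (cube (x + y + z) - cube (x + y) - cube (y + z) - cube (x + z)
       + cube x + cube y + cube z).
Proof.
have crossDr a b c : cross c (a + b) = cross c a + cross c b.
  by rewrite crossC symmetric_crossDl !(crossC c).
have dotDl a b c : dot (a + b) c = dot a c + dot b c.
  by rewrite dotC dotDr !(dotC c).
rewrite !(mulrDr, mulrN) !cubeE !(symmetric_crossDl, crossDr) !(dotDl, dotDr).
rewrite !(crossC y x) !(crossC z x) !(crossC z y).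
rewrite (dot_crossCr x z y) -(dot_crossCA x y z) (dot_crossCr x y x).
rewrite (dot_crossCr x z x) -(dot_crossCA x y y) (dot_crossCr y z y).
rewrite -(dot_crossCA x z z) -(dot_crossCA y z z).
by ring.
Qed.

End SymmetricTrilinear.

Section Trilinear.
Variable A : fieldType.
Hypothesis two0 : (2 : A) != 0.
Implicit Types X Y Z W : jordan A.

Lemma jdotC X Y : jdot X Y = jdot Y X.
Proof.
move: X Y => [[[[[u v] w] x] y] z] [[[[[u' v'] w'] x'] y'] z'].
by rewrite !(jdotE two0) (cdotC x) (cdotC y) (cdotC z); ring.
Qed.

Lemma jdotDl X Y Z : jdot (X + Y) Z = jdot X Z + jdot Y Z.
Proof.
move: X Y Z => [[[[[u v] w] x] y] z] [[[[[u' v'] w'] x'] y'] z'].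
move=> [[[[[u2 v2] w2] x2] y2] z2].
rewrite [jdot (_ + _) _](jdotE two0) !(jdotE two0) !cdotDl /=; ring.
Qed.

Lemma jdotZl k X Z : jdot (k *: X) Z = k * jdot X Z.
Proof.
move: X Z => [[[[[u v] w] x] y] z] [[[[[u' v'] w'] x'] y'] z'].
rewrite [jdot (_ *: _) _](jdotE two0) !(jdotE two0) !cdotZl /= /GRing.scale /=.
by ring.
Qed.

Lemma jdotDr X Y Z : jdot X (Y + Z) = jdot X Y + jdot X Z.
Proof. by rewrite jdotC jdotDl !(jdotC X). Qed.

Lemma jdotZr X k Y : jdot X (k *: Y) = k * jdot X Y.
Proof. by rewrite jdotC jdotZl (jdotC Y). Qed.

Lemma cdot_inj (x y : cayley A) : (forall z, cdot x z = cdot y z) -> x = y.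
Proof.
move: x y => [[[[a b] c] d] [[[e f] g] h]]
  [[[[a' b'] c'] d'] [[[e' f'] g'] h']] E.
have {}E := fun p q => E (p, q).
apply: cayleyP => /=.
- by have := E (1, 0, 0, 0) 0; rewrite /cdot /= !mulr0 !mulr1 !(addr0, add0r).
- by have := E (0, 1, 0, 0) 0; rewrite /cdot /= !mulr0 !mulr1 !(addr0, add0r).
- by have := E (0, 0, 1, 0) 0; rewrite /cdot /= !mulr0 !mulr1 !(addr0, add0r).
- by have := E (0, 0, 0, 1) 0; rewrite /cdot /= !mulr0 !mulr1 !(addr0, add0r).
- by have := E 0 (1, 0, 0, 0); rewrite /cdot /= !mulr0 !mulr1 !(addr0, add0r).
- by have := E 0 (0, 1, 0, 0); rewrite /cdot /= !mulr0 !mulr1 !(addr0, add0r).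
- by have := E 0 (0, 0, 1, 0); rewrite /cdot /= !mulr0 !mulr1 !(addr0, add0r).
- by have := E 0 (0, 0, 0, 1); rewrite /cdot /= !mulr0 !mulr1 !(addr0, add0r).
Qed.

Lemma cdotx0 (x : cayley A) : cdot x 0 = 0.
Proof. by rewrite /cdot /= !mulr0 !addr0. Qed.

Lemma jdot_inj X Y : (forall Z, jdot X Z = jdot Y Z) -> X = Y.
Proof.
move: X Y => [[[[[u v] w] x] y] z] [[[[[u' v'] w'] x'] y'] z'] E.
have {}E a b c p q r : u * a + v * b + w * c + 2 * (cdot x p + cdot y q + cdot z r)
  = u' * a + v' * b + w' * c + 2 * (cdot x' p + cdot y' q + cdot z' r).
  by rewrite -!jdotE.
apply: jordanP => /=.
- by have := E 1 0 0 0 0 0; rewrite !cdotx0 !mulr0 !mulr1 !(addr0, mulr0).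
- by have := E 0 1 0 0 0 0; rewrite !cdotx0 !mulr0 !mulr1 !(addr0, add0r, mulr0).
- by have := E 0 0 1 0 0 0; rewrite !cdotx0 !mulr0 !mulr1 !(addr0, add0r, mulr0).
- apply: cdot_inj => p; apply: (mulfI two0).
  by have := E 0 0 0 p 0 0; rewrite !cdotx0 !mulr0 !(addr0, add0r).
- apply: cdot_inj => p; apply: (mulfI two0).
  by have := E 0 0 0 0 p 0; rewrite !cdotx0 !mulr0 !(addr0, add0r).
- apply: cdot_inj => p; apply: (mulfI two0).
  by have := E 0 0 0 0 0 p; rewrite !cdotx0 !mulr0 !(addr0, add0r).
Qed.

Definition jtri X Y Z := jdot (jcross X Y) Z.

Lemma jcrossC X Y : jcross X Y = jcross Y X.
Proof.
move: X Y => [[[[[u v] w] x] y] z] [[[[[u' v'] w'] x'] y'] z'].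
have E (V : zmodType) (a b c d : V) : a + b - c - d = b + a - d - c.
  by rewrite [a + b]addrC [LHS](AC 4 (1*2*4*3)).
rewrite !(jcrossE two0) (cdotC x) (cdotC y) (cdotC z) !cconjD.
congr (_ *: _); apply: jordanP => /=.
1-3: ring.
all: exact: E.
Qed.

Lemma jtriE u v w x y z u' v' w' x' y' z' u2 v2 w2 x2 y2 z2 :
  jtri (u, v, w, x, y, z) (u', v', w', x', y', z') (u2, v2, w2, x2, y2, z2) =
  2^-1 * ((v * w' + w * v' - 2 * cdot x x') * u2
    + (u * w' + w * u' - 2 * cdot y y') * v2
    + (u * v' + v * u' - 2 * cdot z z') * w2
    + 2 * ((cdot (cconj (cmul y z')) x2 + cdot (cconj (cmul y' z)) x2
            - u * cdot x' x2 - u' * cdot x x2)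
         + (cdot (cconj (cmul z x')) y2 + cdot (cconj (cmul z' x)) y2
            - v * cdot y' y2 - v' * cdot y y2)
         + (cdot (cconj (cmul x y')) z2 + cdot (cconj (cmul x' y)) z2
            - w * cdot z' z2 - w' * cdot z z2))).
Proof.
have E (a b : A) (c1 c2 t1 t2 t : cayley A) :
    cdot (cconj (c1 + c2) - a *: t1 - b *: t2) t
    = cdot (cconj c1) t + cdot (cconj c2) t - a * cdot t1 t - b * cdot t2 t.
  by rewrite cconjD -!scaleNr !cdotDl !cdotZl !mulNr.
by rewrite /jtri (jcrossE two0) jdotZl (jdotE two0) (E u) (E v) (E w).
Qed.

Lemma jtriCr X Y Z : jtri X Y Z = jtri X Z Y.
Proof.
move: X Y Z => [[[[[u v] w] x] y] z] [[[[[u' v'] w'] x'] y'] z'].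
move=> [[[[[u2 v2] w2] x2] y2] z2]; rewrite !jtriE.
rewrite (cdot_conj_cmulC y z' x2) (cdot_conj_cmulC y2 z x').
rewrite (cdot_conj_cmulC z' x2 y) (cdot_conj_cmulC z x' y2).
rewrite (cdot_conj_cmulC y' z x2) (cdot_conj_cmulC y z2 x').
rewrite (cdot_conj_cmulC z' x y2) (cdot_conj_cmulC x y2 z').
rewrite (cdot_conj_cmulC z2 x y') (cdot_conj_cmulC x y' z2).
rewrite (cdot_conj_cmulC z2 x' y) (cdot_conj_cmulC x' y z2).
rewrite (cdotC x2 x') (cdotC y2 y') (cdotC z2 z').
by ring.
Qed.

Lemma jcrossZl k X Z : jcross (k *: X) Z = k *: jcross X Z.
Proof.
exact: (@symmetric_crossZl A (jordan A) _ _ jdotC jdotZr jdot_inj jcrossC jtriCr).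
Qed.

Hypothesis three0 : (3 : A) != 0.

Lemma jdet_cube X : 3 * jdet X = jdot (jcross X X) X.
Proof. by rewrite /jdet (mulVKf three0) [LHS]jdotC. Qed.

Lemma jtri_jdet X Y Z : 6 * jdot (jcross X Y) Z =
  3 * (jdet (X + Y + Z) - jdet (X + Y) - jdet (Y + Z) - jdet (X + Z)
       + jdet X + jdet Y + jdet Z).
Proof.
exact: (@dot_cross_cube A (jordan A) _ _ _ jdotC jdotDr jdot_inj jcrossC jtriCr
  jdet_cube).
Qed.

End Trilinear.

Lemma congr6 (T1 T2 T3 T4 T5 T6 : Type) (a a' : T1) (b b' : T2) (c c' : T3)
    (d d' : T4) (e e' : T5) (f f' : T6) :
  a = a' -> b = b' -> c = c' -> d = d' -> e = e' -> f = f' ->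
  (a, b, c, d, e, f) = (a', b', c', d', e', f').
Proof. by do 6! move=> ->. Qed.

Section Conjugation.
Variable R : realType.
Local Notation C := R[i].
Implicit Types X Y : jordan C.

Lemma complex2_neq0 : (2 : C) != 0. Proof. by rewrite pnatr_eq0. Qed.
Lemma complex3_neq0 : (3 : C) != 0. Proof. by rewrite pnatr_eq0. Qed.

Local Notation cj := (cayley_map (@conjc R)).

Lemma cayley_conjD (x y : cayley C) : cj (x + y) = cj x + cj y.
Proof.
move: x y => [[[[a b] c] d] [[[e f] g] h]]
  [[[[a' b'] c'] d'] [[[e' f'] g'] h']].
by apply: cayleyP; rewrite /= rmorphD.
Qed.

Lemma cayley_conjN (x : cayley C) : cj (- x) = - cj x.
Proof.
move: x => [[[[a b] c] d] [[[e f] g] h]].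
by apply: cayleyP; rewrite /= rmorphN.
Qed.

Lemma cayley_conjZ k (x : cayley C) : cj (k *: x) = (conjc k) *: cj x.
Proof.
move: x => [[[[a b] c] d] [[[e f] g] h]].
by apply: cayleyP; rewrite /= /GRing.scale /= rmorphM.
Qed.

Lemma cayley_conj_cconj (x : cayley C) : cj (cconj x) = cconj (cj x).
Proof.
move: x => [[[[a b] c] d] [[[e f] g] h]].
by apply: cayleyP; rewrite /= ?rmorphN.
Qed.

Lemma cayley_conjM (x y : cayley C) : cj (cmul x y) = cmul (cj x) (cj y).
Proof.
move: x y => [[[[a b] c] d] [[[e f] g] h]]
  [[[[a' b'] c'] d'] [[[e' f'] g'] h']].
by apply: cayleyP; rewrite /= !(rmorphB, rmorphD, rmorphN, rmorphM).
Qed.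

Lemma cdot_conj (x y : cayley C) : cdot (cj x) (cj y) = conjc (cdot x y).
Proof.
move: x y => [[[[a b] c] d] [[[e f] g] h]]
  [[[[a' b'] c'] d'] [[[e' f'] g'] h']].
by rewrite /cdot /= !(rmorphD, rmorphM).
Qed.

Lemma cayley_conjK : involutive cj.
Proof.
by move=> [[[[a b] c] d] [[[e f] g] h]]; rewrite /cayley_map /= !conjcK.
Qed.

Lemma jtauZ k X : jtau (k *: X) = (conjc k) *: jtau X.
Proof.
move: X => [[[[[u v] w] x] y] z].
have E (a : C) : conjc (k * a) = conjc k * conjc a by exact: rmorphM.
exact: (congr6 (E u) (E v) (E w) (cayley_conjZ k x) (cayley_conjZ k y)
  (cayley_conjZ k z)).
Qed.

Lemma jtauK : involutive (@jtau R).
Proof.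
move=> [[[[[u v] w] x] y] z].
by apply: jordanP; rewrite /= ?conjcK ?cayley_conjK.
Qed.

Lemma jtau_cross X Y : jtau (jcross X Y) = jcross (jtau X) (jtau Y).
Proof.
have G (a b c d : C) (x y : cayley C) :
    conjc (a * b + c * d - 2 * cdot x y) =
    conjc a * conjc b + conjc c * conjc d - 2 * cdot (cj x) (cj y).
  by rewrite cdot_conj rmorphB rmorphD !rmorphM rmorph_nat.
move: X Y => [[[[[u v] w] x] y] z] [[[[[u' v'] w'] x'] y'] z'].
rewrite (jcrossE complex2_neq0) [LHS]jtauZ fmorphV rmorph_nat.
rewrite [jtau (_, x', _, _)]/jtau [jtau (_, x, _, _)]/jtau /jordan_map.
rewrite (jcrossE complex2_neq0); congr (_ *: _).
have F (a b : C) (c1 c2 c3 c4 t1 t2 : cayley C) :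
    cj (cconj (cmul c1 c2 + cmul c3 c4) - a *: t1 - b *: t2) =
    cconj (cmul (cj c1) (cj c2) + cmul (cj c3) (cj c4))
    - conjc a *: cj t1 - conjc b *: cj t2.
  by rewrite !(cayley_conjD, cayley_conjN, cayley_conj_cconj, cayley_conjM,
    cayley_conjZ).
exact: (congr6 (G v w' w v' x x') (G u w' w u' y y') (G u v' v u' z z')
  (F u u' y z' y' z x' x) (F v v' z x' z' x y' y) (F w w' x y' x' y z' z)).
Qed.

End Conjugation.

(** * The maps D_a and phi(theta) *)

Section Rotations.
Variable A : fieldType.

(* [D_a] for [a = x + y e1], in coordinates; homogeneous in [(x, y)]. *)
Definition rot1 (x y : A) (c : cayley A) : cayley A :=
  let: ((c0, c1, c2, c3), (c4, c5, c6, c7)) := c in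
  let n := x ^+ 2 + y ^+ 2 in
  (((x ^+ 2 - y ^+ 2) * c0 + 2 * x * y * c1,
    (x ^+ 2 - y ^+ 2) * c1 - 2 * x * y * c0, n * c2, n * c3),
   (n * c4, n * c5, n * c6, n * c7)).

Definition rot2 (x y : A) (c : cayley A) : cayley A :=
  let: ((c0, c1, c2, c3), (c4, c5, c6, c7)) := c in
  ((x * c0 - y * c1, x * c1 + y * c0, x * c2 - y * c3, x * c3 + y * c2),
   (x * c4 - y * c5, x * c5 + y * c4, x * c6 + y * c7, x * c7 - y * c6)).

Definition rot3 (x y : A) (c : cayley A) : cayley A :=
  let: ((c0, c1, c2, c3), (c4, c5, c6, c7)) := c in
  ((x * c0 - y * c1, x * c1 + y * c0, x * c2 + y * c3, x * c3 - y * c2),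
   (x * c4 + y * c5, x * c5 - y * c4, x * c6 - y * c7, x * c7 + y * c6)).

Definition jrot (x y : A) (X : jordan A) : jordan A :=
  let: (u, v, w, x1, x2, x3) := X in
  (u, v, w, rot1 x y x1, rot2 x y x2, rot3 x y x3).

Lemma cdot_rot1 x y c d :
  cdot (rot1 x y c) (rot1 x y d) = (x ^+ 2 + y ^+ 2) ^+ 2 * cdot c d.
Proof.
move: c d => [[[[a b] c] d] [[[e f] g] h]]
  [[[[a' b'] c'] d'] [[[e' f'] g'] h']].
by rewrite /cdot /=; ring.
Qed.

Lemma cdot_rot2 x y c d :
  cdot (rot2 x y c) (rot2 x y d) = (x ^+ 2 + y ^+ 2) * cdot c d.
Proof.
move: c d => [[[[a b] c] d] [[[e f] g] h]]
  [[[[a' b'] c'] d'] [[[e' f'] g'] h']].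
by rewrite /cdot /=; ring.
Qed.

Lemma cdot_rot3 x y c d :
  cdot (rot3 x y c) (rot3 x y d) = (x ^+ 2 + y ^+ 2) * cdot c d.
Proof.
move: c d => [[[[a b] c] d] [[[e f] g] h]]
  [[[[a' b'] c'] d'] [[[e' f'] g'] h']].
by rewrite /cdot /=; ring.
Qed.

Lemma cdot_cmul_rot x y c1 c2 c3 :
  cdot (cconj (cmul (rot1 x y c1) (rot2 x y c2))) (rot3 x y c3) =
  (x ^+ 2 + y ^+ 2) ^+ 2 * cdot (cconj (cmul c1 c2)) c3.
Proof.
move: c1 c2 c3 => [[[[a b] c] d] [[[e f] g] h]]
  [[[[a' b'] c'] d'] [[[e' f'] g'] h']]
  [[[[a'' b''] c''] d''] [[[e'' f''] g''] h'']].
by rewrite /cdot /=; ring.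
Qed.

End Rotations.

Section DetFormula.
Variable A : fieldType.
Hypotheses (two0 : (2 : A) != 0) (three0 : (3 : A) != 0).

Lemma jdetE u v w x y z : jdet ((u, v, w, x, y, z) : jordan A) =
  u * v * w - u * cdot x x - v * cdot y y - w * cdot z z
  + 2 * cdot (cconj (cmul x y)) z.
Proof.
apply: (mulfI three0).
rewrite (jdet_cube two0 three0) -[LHS]/(jtri _ _ _) (jtriE two0).
rewrite (cdot_conj_cmulC z x y) (cdot_conj_cmulC y z x) (cdot_conj_cmulC z x y).
by field.
Qed.

End DetFormula.

Section RotationGroup.
Variable R : realType.
Local Notation C := R[i].

Lemma dmapE (x y : R) X : dmap (x, y, 0, 0) X = jrot x y X.
Proof.
move: X => [[[[[u v] w]
  [[[[a b] c] d] [[[e f] g] h]]]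
  [[[[a' b'] c'] d'] [[[e' f'] g'] h']]]
  [[[[a'' b''] c''] d''] [[[e'' f''] g''] h'']]].
apply: (congr6 erefl erefl erefl); apply: cayleyP; rewrite /=; ring.
Qed.

Lemma cext_rot (x y : R) X : cext (jrot x y) X = jrot x%:C y%:C X.
Proof.
move: X => [[[[[u v] w]
  [[[[[a a1] [b b1]] [c c1]] [d d1]] [[[[e e1] [f f1]] [g g1]] [h h1]]]]
  [[[[[a' a1'] [b' b1']] [c' c1']] [d' d1']]
    [[[[e' e1'] [f' f1']] [g' g1']] [h' h1']]]]
  [[[[[a2 a12] [b2 b12]] [c2 c12]] [d2 d12]]
    [[[[e2 e12] [f2 f12]] [g2 g12]] [h2 h12]]]].
rewrite /cext jordan_rcDi; apply: congr6.
1-3: by [case: u| case: v | case: w].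
all: apply: cayleyP; rewrite -[RHS]/(Complex _ _) /=; congr Complex; ring.
Qed.

End RotationGroup.

Section IntrinsicForms.
Variables (K : fieldType) (V : lmodType K).
Variables (dot : V -> V -> K) (cross : V -> V -> V) (e a0 a1 : V).

(* For [e = E1], [a0 = F1(1)], [a1 = F1(e1)], [weight_form] gives [phi(theta)] and
   [rot_form] gives [D_(r + s e1)]. Only the operations of the Jordan algebra and
   these three elements occur in the formulas, so the forms commute with every
   map that preserves the operations and fixes the elements. *)
Definition proj_e x := dot e x *: e.
Definition proj_v x := 4 *: cross e (cross e x).
Definition proj_s x := x - proj_e x - proj_v x.

Definition weight_form (k1 k2 k3 : K) x :=
  k1 *: proj_e x + k2 *: proj_v x + k3 *: proj_s x.

Definition rot_form (r s : K) x :=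
  let c := r ^+ 2 - s ^+ 2 - 1 in
  weight_form 1 1 r x
  + ((c * dot a0 x + 2 * r * s * dot a1 x) / 2) *: a0
  + ((c * dot a1 x - 2 * r * s * dot a0 x) / 2) *: a1
  + (- 4 * s) *: cross a1 (cross a0 (proj_s x)).

Variable f : lin_iso V.

Lemma lin_isoD x y : f (x + y) = f x + f y.
Proof. by rewrite -[x]scale1r lin_iso_linear !scale1r. Qed.

Lemma lin_iso0 : f 0 = 0.
Proof. by apply: (addrI (f 0)); rewrite -lin_isoD !addr0. Qed.

Lemma lin_isoZ k x : f (k *: x) = k *: f x.
Proof. by rewrite -[k *: x]addr0 lin_iso_linear lin_iso0 addr0. Qed.

Lemma lin_isoN x : f (- x) = - f x.
Proof. by rewrite -!scaleN1r lin_isoZ. Qed.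

Hypotheses (fe : f e = e) (fa0 : f a0 = a0) (fa1 : f a1 = a1).
Hypothesis dot_f : forall b x, [\/ b = e, b = a0 | b = a1] -> dot b (f x) = dot b x.
Hypothesis cross_f : forall b c x,
  [\/ b = e, b = a0 | b = a1] -> [\/ c = e, c = a0 | c = a1] ->
  f (cross b (cross c x)) = cross b (cross c (f x)).

Lemma proj_e_comm x : f (proj_e x) = proj_e (f x).
Proof. by rewrite /proj_e lin_isoZ fe dot_f //; constructor 1. Qed.

Lemma proj_v_comm x : f (proj_v x) = proj_v (f x).
Proof. by rewrite /proj_v lin_isoZ cross_f //; constructor 1. Qed.

Lemma proj_s_comm x : f (proj_s x) = proj_s (f x).
Proof.
by rewrite /proj_s !lin_isoD !lin_isoN (proj_e_comm x) (proj_v_comm x).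
Qed.

Lemma weight_form_comm k1 k2 k3 x :
  f (weight_form k1 k2 k3 x) = weight_form k1 k2 k3 (f x).
Proof.
rewrite /weight_form !lin_isoD (lin_isoZ k1) (lin_isoZ k2) (lin_isoZ k3).
by rewrite (proj_e_comm x) (proj_v_comm x) (proj_s_comm x).
Qed.

Lemma rot_form_comm r s x : f (rot_form r s x) = rot_form r s (f x).
Proof.
have m0 : [\/ a0 = e, a0 = a0 | a0 = a1] by constructor 2.
have m1 : [\/ a1 = e, a1 = a0 | a1 = a1] by constructor 3.
rewrite /rot_form 3!lin_isoD 3!lin_isoZ (weight_form_comm 1 1 r x) fa0 fa1.
by rewrite cross_f // !dot_f // (proj_s_comm x).
Qed.

End IntrinsicForms.

Section HermitianIsometries.
Variables (K : fieldType) (V : lmodType K).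
Variables (dot : V -> V -> K) (cross : V -> V -> V) (cube : V -> K).
Variables (tau : V -> V) (f : lin_iso V).
Hypotheses (dot_inj : forall x y, (forall z, dot x z = dot y z) -> x = y)
  (six0 : (6 : K) != 0)
  (polar : forall x y z, 6 * dot (cross x y) z =
    3 * (cube (x + y + z) - cube (x + y) - cube (y + z) - cube (x + z)
         + cube x + cube y + cube z))
  (tauK : involutive tau)
  (tau_cross : forall x y, tau (cross x y) = cross (tau x) (tau y))
  (cube_f : forall x, cube (f x) = cube x)
  (dot_f : forall x y, dot (tau (f x)) (f y) = dot (tau x) y).

Lemma isometry_cross x y : cross (f x) (f y) = tau (f (tau (cross x y))).
Proof.
apply: dot_inj => z; rewrite -[z](lin_isoVK f); set w := lin_isoV f z.
rewrite dot_f tauK; apply: (mulfI six0).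
by rewrite !polar -!lin_isoD !cube_f.
Qed.

Lemma isometry_fixed_cross b c x : tau b = b -> f b = b -> f c = c ->
  f (cross b (cross c x)) = cross b (cross c (f x)).
Proof.
move=> tb fb fc; rewrite -{2}fc isometry_cross.
rewrite -{2}tb -tau_cross -{2}fb isometry_cross !tauK.
by rewrite tau_cross tauK tb.
Qed.

Lemma isometry_fixed_dot b x : tau b = b -> f b = b -> dot b (f x) = dot b x.
Proof. by move=> tb fb; rewrite -{1}tb -{1}fb dot_f tb. Qed.

End HermitianIsometries.

Section JordanForms.
Variable A : fieldType.
Hypothesis two0 : (2 : A) != 0.

Local Notation E1 := (jE1 A).
Local Notation A0 := (jF1 (scal_cayley (1 : A))).
Local Notation A1 := (jF1 (cayley_e1 A)).

Local Notation J := (jordan A : lmodType A).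

Lemma jscaleE (k : A) (u v w : A) (x y z : cayley A) :
  k *: ((u, v, w, x, y, z) : J) =
  (k * u, k * v, k * w, k *: x, k *: y, k *: z).
Proof. exact: erefl. Qed.

Lemma jaddE (u v w : A) (x y z : cayley A) (u' v' w' : A)
    (x' y' z' : cayley A) :
  ((u, v, w, x, y, z) : J) + (u', v', w', x', y', z') =
  (u + u', v + v', w + w', x + x', y + y', z + z').
Proof. exact: erefl. Qed.

Lemma jadd4E (u v w : A) (x y z : cayley A) (u' v' w' : A) (x' y' z' : cayley A)
    (u2 v2 w2 : A) (x2 y2 z2 : cayley A) (u3 v3 w3 : A) (x3 y3 z3 : cayley A) :
  ((u, v, w, x, y, z) : J) + (u', v', w', x', y', z')
    + (u2, v2, w2, x2, y2, z2) + (u3, v3, w3, x3, y3, z3) =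
  (u + u' + u2 + u3, v + v' + v2 + v3, w + w' + w2 + w3,
   x + x' + x2 + x3, y + y' + y2 + y3, z + z' + z2 + z3).
Proof. exact: erefl. Qed.

Lemma joppE (u v w : A) (x y z : cayley A) : - ((u, v, w, x, y, z) : J) =
  (- u, - v, - w, - x, - y, - z).
Proof. exact: erefl. Qed.

Lemma cmul0l (x : cayley A) : cmul 0 x = 0.
Proof.
move: x => [[[[a b] c] d] [[[e f] g] h]].
by apply: cayleyP; rewrite /=; ring.
Qed.

Lemma cmul0r (x : cayley A) : cmul x 0 = 0.
Proof.
move: x => [[[[a b] c] d] [[[e f] g] h]].
by apply: cayleyP; rewrite /=; ring.
Qed.

Lemma cconj0 : cconj 0 = 0 :> cayley A.
Proof. by apply: cayleyP; rewrite /= ?oppr0. Qed.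

Lemma cdot0x (x : cayley A) : cdot 0 x = 0.
Proof. by rewrite cdotC cdotx0. Qed.

Lemma jcross_jE1 (u v w : A) (x y z : cayley A) :
  jcross E1 (u, v, w, x, y, z) =
  ((0, 2^-1 * w, 2^-1 * v, - 2^-1 *: x, 0, 0) : jordan A).
Proof.
rewrite (jcrossE two0) !cmul0l !cmul0r !cdot0x !addr0 !cconj0 !scaler0 !scale0r.
rewrite !subr0 !sub0r.
apply: congr6; rewrite ?scaler0 ?scale1r //.
4: by rewrite scalerN scaleNr.
all: by rewrite /GRing.scale /=; ring.
Qed.

Lemma jdot_jE1 (u v w : A) (x y z : cayley A) :
  jdot E1 ((u, v, w, x, y, z) : jordan A) = u.
Proof.
by rewrite (jdotE two0) !cdot0x; ring.
Qed.

Lemma jdot_jF1 c (u v w : A) (x y z : cayley A) :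
  jdot (jF1 c) ((u, v, w, x, y, z) : jordan A) = 2 * cdot c x.
Proof.
by rewrite /jF1 (jdotE two0) !cdot0x; ring.
Qed.

Lemma jcross_jF1 (c : cayley A) (u v w : A) (x y z : cayley A) :
  jcross (jF1 c) ((u, v, w, x, y, z) : jordan A) =
  ((- cdot c x, 0, 0, - (2^-1 * u) *: c, 2^-1 *: cconj (cmul z c),
    2^-1 *: cconj (cmul c y)) : jordan A).
Proof.
rewrite /jF1 (jcrossE two0) !cmul0l !cmul0r !cdot0x !addr0 !add0r !scaler0 !scale0r.
rewrite !subr0 cconj0 sub0r.
apply: congr6.
4: by rewrite scalerN scalerA scaleNr.
1-3: by rewrite /GRing.scale /=; field.
all: by [].
Qed.

Lemma jproj_eE (u v w : A) (x y z : cayley A) :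
  proj_e (@jdot A) E1 (u, v, w, x, y, z) = (u, 0, 0, 0, 0, 0).
Proof.
by rewrite /proj_e jdot_jE1 jscaleE !mulr0 mulr1 !scaler0.
Qed.

Lemma jproj_vE (u v w : A) (x y z : cayley A) :
  proj_v (@jcross A) E1 (u, v, w, x, y, z) = (0, v, w, x, 0, 0).
Proof.
have E (a : A) : 4 * (2^-1 * (2^-1 * a)) = a by field.
have E' : (4 : A) * - 2^-1 * - 2^-1 = 1 by field.
rewrite /proj_v !jcross_jE1 jscaleE mulr0 !scaler0 !E !scalerA.
by rewrite mulrA E' scale1r.
Qed.

Lemma jproj_sE (u v w : A) (x y z : cayley A) :
  proj_s (@jdot A) (@jcross A) E1 (u, v, w, x, y, z) = (0, 0, 0, 0, y, z).
Proof.
by rewrite /proj_s jproj_eE jproj_vE !joppE !jaddE !subrr !oppr0 !addr0 !subrr.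
Qed.

Lemma weight_formE (k1 k2 k3 : A) (u v w : A) (x y z : cayley A) :
  weight_form (@jdot A) (@jcross A) E1 k1 k2 k3 (u, v, w, x, y, z) =
  (k1 * u, k2 * v, k2 * w, k2 *: x, k3 *: y, k3 *: z).
Proof.
rewrite /weight_form jproj_eE jproj_vE jproj_sE !jscaleE !jaddE.
by rewrite !mulr0 !scaler0 !addr0 !add0r.
Qed.

Lemma jcross_A1_A0 (y z : cayley A) :
  jcross A1 (jcross A0 ((0, 0, 0, 0, y, z) : jordan A)) =
  ((0, 0, 0, 0, - 4^-1 *: rot2 0 1 y, - 4^-1 *: rot3 0 1 z) : jordan A).
Proof.
have four0 : (4 : A) != 0 by rewrite -[4%N]/(2 * 2)%N natrM mulf_neq0.
have E (c y' z' : cayley A) : jcross (jF1 c) ((0, 0, 0, 0, y', z') : jordan A) =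
    ((0, 0, 0, 0, 2^-1 *: cconj (cmul z' c), 2^-1 *: cconj (cmul c y'))
     : jordan A).
  by rewrite jcross_jF1 cdotx0 mulr0 oppr0 scale0r.
rewrite E E; apply: (congr6 erefl erefl erefl erefl).
- move: y => [[[[a b] c] d] [[[e f] g] h]].
  apply: cayleyP; rewrite /= /GRing.scale /= /GRing.scale /=;
    by field; rewrite ?four0 ?two0.
- move: z => [[[[a b] c] d] [[[e f] g] h]].
  apply: cayleyP; rewrite /= /GRing.scale /= /GRing.scale /=;
    by field; rewrite ?four0 ?two0.
Qed.

Lemma rot_formE (r s : A) (X : jordan A) : r ^+ 2 + s ^+ 2 = 1 ->
  rot_form (@jdot A) (@jcross A) E1 A0 A1 r s X = jrot r s X.
Proof.
move: X => [[[[[u v] w] x] y] z] rs1.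
have four0 : (4 : A) != 0 by rewrite -[4%N]/(2 * 2)%N natrM mulf_neq0.
rewrite /rot_form weight_formE jproj_sE !jdot_jF1 jcross_A1_A0 /jF1 3!jscaleE.
rewrite jadd4E.
have S (k a : A) : a + k * 0 + 0 + 0 = a by rewrite mulr0 !addr0.
have S0 (k m l a : A) : 1 * a + k * 0 + m * 0 + l * 0 = a.
  by rewrite mul1r !mulr0 !addr0.
have T0 (k m : A) (a b : cayley A) : a + k *: 0 + m *: 0 + b = a + b.
  by rewrite !scaler0 !addr0.
apply: congr6; rewrite ?S0 ?T0 //.
- move: x => [[[[a b] c] d] [[[e f] g] h]].
  rewrite scaler0 addr0.
  by apply: cayleyP; rewrite /cdot /= ?rs1 /GRing.scale /= /GRing.scale /=; field.
- move: y => [[[[a b] c] d] [[[e f] g] h]].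
  by apply: cayleyP; rewrite /= /GRing.scale /= /GRing.scale /=; field.
- move: z => [[[[a b] c] d] [[[e f] g] h]].
  by apply: cayleyP; rewrite /= /GRing.scale /= /GRing.scale /=; field.
Qed.

End JordanForms.

Lemma lin_isoME (K : fieldType) (V : lmodType K) (f g : lin_iso V) v :
  (f * g)%g v = f (g v).
Proof. by []. Qed.

Lemma lin_iso1E (K : fieldType) (V : lmodType K) (v : V) :
  (1%g : lin_iso V) v = v.
Proof. by []. Qed.

Local Opaque jdet.

Section GenericRotation.
Variable A : fieldType.
Hypotheses (two0 : (2 : A) != 0) (three0 : (3 : A) != 0).

Lemma jdet_jrot (x y : A) X : x ^+ 2 + y ^+ 2 = 1 -> jdet (jrot x y X) = jdet X.
Proof.
move: X => [[[[[u v] w] a] b] c] xy1.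
rewrite /jrot !(jdetE two0 three0) cdot_rot1 cdot_rot2 cdot_rot3 cdot_cmul_rot.
by rewrite xy1 expr1n !mul1r.
Qed.

Lemma jdot_jrot (x y : A) X Y : x ^+ 2 + y ^+ 2 = 1 ->
  jdot (jrot x y X) (jrot x y Y) = jdot X Y.
Proof.
move: X Y => [[[[[u v] w] a] b] c] [[[[[u' v'] w'] a'] b'] c'] xy1.
rewrite /jrot !(jdotE two0) cdot_rot1 cdot_rot2 cdot_rot3.
by rewrite xy1 expr1n !mul1r.
Qed.

Lemma jrotM (x y x' y' : A) X :
  jrot x y (jrot x' y' X) = jrot (x * x' - y * y') (x * y' + y * x') X.
Proof.
move: X => [[[[[u v] w]
  [[[[a b] c] d] [[[e f] g] h]]]
  [[[[a' b'] c'] d'] [[[e' f'] g'] h']]]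
  [[[[a'' b''] c''] d''] [[[e'' f''] g''] h'']]].
by apply: (congr6 erefl erefl erefl); apply: cayleyP; rewrite /=; ring.
Qed.

End GenericRotation.

Section E6Members.
Variable R : realType.
Local Notation C := R[i].
Implicit Types (X Y : jordan C) (z t : U1 R) (f g : lin_iso (jordan C)).

Local Notation two0 := (complex2_neq0 R).
Local Notation three0 := (complex3_neq0 R).

Lemma complex6_neq0 : (6 : C) != 0. Proof. by rewrite pnatr_eq0. Qed.

Lemma E6_cross f X Y : E6 f -> jcross (f X) (f Y) = jtau (f (jtau (jcross X Y))).
Proof.
move=> [fdet fherm].
exact: (@isometry_cross C (jordan C) _ _ _ _ _ (jdot_inj two0) complex6_neq0
  (jtri_jdet two0 three0) (@jtauK R) fdet fherm).
Qed.

Lemma E6_cross_inv f X Y : E6 f ->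
  f (jcross X Y) = jtau (jcross (f (jtau X)) (f (jtau Y))).
Proof. by move=> fE; rewrite E6_cross // jtauK -jtau_cross jtauK. Qed.

Lemma E6_fixed_cross f B D X : E6 f -> jtau B = B -> f B = B -> f D = D ->
  f (jcross B (jcross D X)) = jcross B (jcross D (f X)).
Proof.
move=> [fdet fherm].
exact: (@isometry_fixed_cross C (jordan C) _ _ _ _ _ (jdot_inj two0)
  complex6_neq0 (jtri_jdet two0 three0) (@jtauK R) (@jtau_cross R) fdet fherm).
Qed.

Lemma E6_fixed_dot f B X : E6 f -> jtau B = B -> f B = B ->
  jdot B (f X) = jdot B X.
Proof.
move=> [fdet fherm].
exact: (@isometry_fixed_dot C (jordan C) (@jdot C) (@jtau R) f fherm).
Qed.

Lemma E6_subgroup : subgroup (@E6 R).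
Proof.
split.
- by split.
- move=> f g [f1 f2] [g1 g2]; split=> [X | X Y].
    by rewrite lin_isoME f1 g1.
  by rewrite !lin_isoME f2 g2.
- move=> f [f1 f2]; split=> [X | X Y].
    by rewrite -(f1 (f^-1%g X)) -lin_isoME mulgV.
  by rewrite -(f2 (f^-1%g X)) -!lin_isoME mulgV.
Qed.

Lemma circ_subproof z : complex.Re z ^+ 2 + complex.Im z ^+ 2 = 1.
Proof.
case: z => [[x y] zP] /=; move: (zP).
by rewrite eq_complex /= mulNr opprK => /andP[/eqP <- _]; rewrite !expr2.
Qed.

Definition circ z : unit_C R := mk_unit_C (circ_subproof z).

Definition Dz z : lin_iso (jordan C) := D_iso (circ z).

Local Notation cx z := ((complex.Re z)%:C).
Local Notation cy z := ((complex.Im z)%:C).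

Lemma DzE z X : Dz z X = jrot (cx z) (cy z) X.
Proof.
rewrite /Dz /D_iso /= -cext_rot /cext.
by rewrite !dmapE.
Qed.

Lemma circ_complex z : cx z ^+ 2 + cy z ^+ 2 = 1.
Proof. by rewrite -!rmorphXn -rmorphD circ_subproof. Qed.

Lemma unit_C_circ (a : unit_C R) : exists z, D_iso a = Dz z.
Proof.
have [x [y axy]] := unit_CP a; have := unit_C_norm a; rewrite axy => h.
have xy1 : x ^+ 2 + y ^+ 2 = 1.
  move: h; rewrite /qnorm expr0n /= !addr0 => h.
  by rewrite -[LHS]sqr_sqrtr ?addr_ge0 ?sqr_ge0 // h expr1n.
have zP : conjc (x +i* y) * (x +i* y) == 1.
  apply/eqP; rewrite -[LHS]/(Complex _ _); congr Complex; last by ring.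
  by rewrite mulNr opprK -!expr2.
exists (MkU1 zP); apply: lin_iso_eq => X.
by rewrite DzE -cext_rot /D_iso /= axy /cext !dmapE.
Qed.

Lemma jtau_jrot (x y : C) X : conjc x = x -> conjc y = y ->
  jtau (jrot x y X) = jrot x y (jtau X).
Proof.
move=> cjx cjy.
have E (a b : C) : conjc (x * a - y * b) = x * conjc a - y * conjc b.
  by rewrite rmorphB !rmorphM /= cjx cjy.
have F (a b : C) : conjc (x * a + y * b) = x * conjc a + y * conjc b.
  by rewrite rmorphD !rmorphM /= cjx cjy.
have G (a : C) : conjc ((x ^+ 2 + y ^+ 2) * a) = (x ^+ 2 + y ^+ 2) * conjc a.
  by rewrite rmorphM rmorphD !rmorphXn /= cjx cjy.
have H (a b : C) : conjc ((x ^+ 2 - y ^+ 2) * a + 2 * x * y * b) =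
    (x ^+ 2 - y ^+ 2) * conjc a + 2 * x * y * conjc b.
  by rewrite rmorphD !rmorphM rmorphB !rmorphXn rmorph_nat /= cjx cjy.
have I (a b : C) : conjc ((x ^+ 2 - y ^+ 2) * a - 2 * x * y * b) =
    (x ^+ 2 - y ^+ 2) * conjc a - 2 * x * y * conjc b.
  by rewrite rmorphB !rmorphM rmorphB !rmorphXn rmorph_nat /= cjx cjy.
move: X => [[[[[u v] w]
  [[[[a b] c] d] [[[e f] g] h]]]
  [[[[a' b'] c'] d'] [[[e' f'] g'] h']]]
  [[[[a'' b''] c''] d''] [[[e'' f''] g''] h'']]].
apply: (congr6 erefl erefl erefl).
- by rewrite /rot1 /cayley_map /= H I !G.
- by rewrite /rot2 /cayley_map /= !E !F.
- by rewrite /rot3 /cayley_map /= !E !F.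
Qed.

Lemma Dz_E6 z : E6 (Dz z).
Proof.
have cr (r : R) : conjc r%:C = r%:C by rewrite /= oppr0.
split=> [X | X Y].
  rewrite DzE; exact: (jdet_jrot two0 three0 _ (circ_complex z)).
rewrite (DzE z X) (DzE z Y) /jherm (jtau_jrot X (cr _) (cr _)).
exact: (jdot_jrot two0 _ _ (circ_complex z)).
Qed.

Lemma U1_neq0 z : (z : C) != 0.
Proof.
by apply/eqP => z0; have := U1P z; rewrite z0 mulr0 eq_sym oner_eq0.
Qed.

Lemma U1_conj z : conjc (z : C) = (z : C)^-1.
Proof.
by apply: (mulIf (U1_neq0 z)); rewrite mulVf ?U1_neq0 //; apply/eqP/U1P.
Qed.

Lemma phi_E6 t : E6 (phi_iso t).
Proof.
have W (k l : C) (a b : cayley C) : cdot (k *: a) (l *: b) = k * l * cdot a b.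
  by rewrite cdotZl cdotC cdotZl cdotC; ring.
have t0 := U1_neq0 t; have tV := U1_conj t.
split=> [[[[[[u v] w] x] y] z] | X Y].
  rewrite [phi_iso t _]/(phi_map _ _).
  rewrite /phi_map !(jdetE two0 three0) cmulZl cmulZr scalerA cconjZ !W.
  by move: (t : C) t0 {tV} => {}t t0; field.
move: X Y => [[[[[u v] w] x] y] z] [[[[[u' v'] w'] x'] y'] z'].
rewrite /jherm -[phi_iso t _]/(phi_map _ _) -[phi_iso t (_, x', _, _)]/(phi_map _ _).
rewrite /phi_map /jtau /jordan_map !(jdotE two0) !cayley_conjZ !W.
have E2 : conjc ((t : C) ^- 2) = (t : C) ^+ 2.
  by rewrite fmorphV rmorphXn /= tV exprVn invrK.
have E4 (a : C) : conjc ((t : C) ^+ 4 * a) = (t : C) ^- 4 * conjc a.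
  by rewrite rmorphM rmorphXn /= tV exprVn.
have E2M (a : C) : conjc ((t : C) ^- 2 * a) = (t : C) ^+ 2 * conjc a.
  by rewrite rmorphM /= E2.
rewrite E4 !E2M E2 tV {E2 E4 E2M}.
by move: (t : C) t0 {tV} => {}t t0; field.
Qed.

End E6Members.

Section Spin.
Variable R : realType.
Local Notation C := R[i].
Local Notation JC := (jordan C).
Implicit Types (X Y : JC) (z t : U1 R) (f g : lin_iso JC).

Local Notation E1 := (jE1 C).
Local Notation A0 := (jF1 (scal_cayley (1 : C))).
Local Notation A1 := (jF1 (cayley_e1 C)).
Local Notation cx z := ((complex.Re z)%:C).
Local Notation cy z := ((complex.Im z)%:C).
Local Notation two0 := (complex2_neq0 R).

Lemma jtau_jE1 : jtau E1 = E1.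
Proof. by rewrite /jtau /jE1 /= /cayley_map /= !oppr0. Qed.

Lemma jtau_A0 : jtau A0 = A0.
Proof. by rewrite /jtau /jE1 /= /cayley_map /= !oppr0. Qed.

Lemma jtau_A1 : jtau A1 = A1.
Proof. by rewrite /jtau /jE1 /= /cayley_map /= !oppr0. Qed.

Lemma phi_weight t X : phi_iso t X =
  weight_form (@jdot C) (@jcross C) E1 ((t : C) ^+ 4) ((t : C) ^- 2) t X.
Proof. by move: X => [[[[[u v] w] x] y] z]; rewrite weight_formE. Qed.

Lemma Dz_rot_form z X : Dz z X =
  rot_form (@jdot C) (@jcross C) E1 A0 A1 (cx z) (cy z) X.
Proof. by rewrite DzE -(rot_formE two0) ?circ_complex. Qed.

Lemma E6_jE1_phi f t : E6 f -> f E1 = E1 -> (f * phi_iso t = phi_iso t * f)%g.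
Proof.
move=> fE fe; apply: lin_iso_eq => X; rewrite !lin_isoME !phi_weight.
apply: (@weight_form_comm C JC (@jdot C) (@jcross C) E1 E1 E1 f fe).
- by move=> b {}X; case=> ->; exact: (E6_fixed_dot X fE jtau_jE1 fe).
- by move=> b c {}X; case=> -> [] ->; exact: (E6_fixed_cross X fE jtau_jE1 fe fe).
Qed.

Lemma Spin8_Dz f z : Spin8 f -> (f * Dz z = Dz z * f)%g.
Proof.
move=> [fE fe fa0 fa1]; apply: lin_iso_eq => X.
rewrite !lin_isoME !Dz_rot_form.
have fixed b : [\/ b = E1, b = A0 | b = A1] -> jtau b = b /\ f b = b.
  case=> eqb; rewrite eqb; [exact: (conj jtau_jE1 fe)
    | exact: (conj jtau_A0 fa0) | exact: (conj jtau_A1 fa1)].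
apply: (@rot_form_comm C JC (@jdot C) (@jcross C) E1 A0 A1 f fe fa0 fa1).
- by move=> b {}X /fixed[tb fb]; exact: (E6_fixed_dot X fE tb fb).
- move=> b c {}X /fixed[tb fb] /fixed[_ fc].
  exact: (E6_fixed_cross X fE tb fb fc).
Qed.

Lemma DzM z w : Dz (z * w)%g = (Dz z * Dz w)%g.
Proof.
apply: lin_iso_eq => X; rewrite lin_isoME !DzE jrotM.
case: z w => [[x y] zP] [[x' y'] wP].
by rewrite -!rmorphM -rmorphB -rmorphD.
Qed.

Lemma jrot1 X : jrot 1 0 X = X.
Proof.
move: X => [[[[[u v] w]
  [[[[a b] c] d] [[[e f] g] h]]]
  [[[[a' b'] c'] d'] [[[e' f'] g'] h']]]
  [[[[a'' b''] c''] d''] [[[e'' f''] g''] h'']]].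
by apply: (congr6 erefl erefl erefl); apply: cayleyP; rewrite /=; ring.
Qed.

Lemma Dz1 : Dz 1%g = 1%g :> lin_iso JC.
Proof. by apply: lin_iso_eq => X; rewrite DzE jrot1. Qed.

Lemma DzV z : Dz z^-1%g = (Dz z)^-1%g.
Proof. by apply/eqP; rewrite -mulg_eq1 -DzM mulVg Dz1. Qed.

Lemma phiM t s : phi_iso (t * s)%g = (phi_iso t * phi_iso s)%g.
Proof.
apply: lin_iso_eq => -[[[[[u v] w] x] y] z]; rewrite lin_isoME.
rewrite /phi_iso /phi_map /=.
by rewrite !exprMn !invfM !scalerA !mulrA.
Qed.

Lemma phi1 : phi_iso 1%g = 1%g :> lin_iso JC.
Proof.
apply: lin_iso_eq => -[[[[[u v] w] x] y] z].
rewrite /phi_iso /phi_map /=.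
by rewrite !expr1n invr1 !scale1r !mul1r.
Qed.

Lemma phiV t : phi_iso t^-1%g = (phi_iso t)^-1%g.
Proof. by apply/eqP; rewrite -mulg_eq1 -phiM mulVg phi1. Qed.

Lemma Dz_jE1 z : Dz z E1 = E1.
Proof.
rewrite DzE; apply: (congr6 erefl erefl erefl); rewrite /= ?mulr0.
all: by rewrite !(subr0, addr0).
Qed.

Lemma Dz_phi z t : (Dz z * phi_iso t = phi_iso t * Dz z)%g.
Proof. exact: (E6_jE1_phi _ (Dz_E6 z) (Dz_jE1 z)). Qed.

Lemma Spin8_subgroup : subgroup (@Spin8 R).
Proof.
have [E61 E6M E6V] := E6_subgroup R.
split.
- by split.
- move=> f g [fE f1 f2 f3] [gE g1 g2 g3]; split; first exact: E6M.
  + by rewrite lin_isoME g1.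
  + by rewrite lin_isoME g2.
  + by rewrite lin_isoME g3.
- move=> f [fE f1 f2 f3]; split; first exact: E6V.
  + by rewrite -{1}f1 -lin_isoME mulVg.
  + by rewrite -{1}f2 -lin_isoME mulVg.
  + by rewrite -{1}f3 -lin_isoME mulVg.
Qed.

Lemma Spin2P f : Spin2 f <-> exists z, f = Dz z.
Proof.
split=> [[a _ <-] | [z ->]]; first exact: unit_C_circ.
by exists (circ z).
Qed.

End Spin.

(** * The centralizer of sigma3 *)

Section Sigma3.
Variable R : realType.
Local Notation C := R[i].
Local Notation JC := (jordan C).
Implicit Types (X Y Z : JC) (z t : U1 R) (f g : lin_iso JC).

Local Notation E1 := (jE1 C).
Local Notation two0 := (complex2_neq0 R).

Local Notation ox := ((- (1 / 2) : R)%:C).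
Local Notation oy := ((Num.sqrt 3 / 2 : R)%:C).

Lemma omega_sq : oy ^+ 2 = 3 / 4 :> C.
Proof.
rewrite -rmorphXn expr_div_n sqr_sqrtr ?ler0n // fmorph_div !rmorph_nat /=.
by field.
Qed.

Lemma omegaxE : ox = - 2^-1 :> C.
Proof. by rewrite rmorphN fmorph_div rmorph1 rmorph_nat div1r. Qed.

Lemma sigma3E X : sigma3 R X = jrot (- 2^-1) oy X.
Proof. by rewrite -omegaxE -cext_rot /sigma3 /D_iso /= /cext !dmapE. Qed.

Lemma omega_norm : (- 2^-1) ^+ 2 + oy ^+ 2 = 1 :> C.
Proof. by rewrite omega_sq; field. Qed.

Lemma rotation_fixed0 (p q a b : C) : (p - 1) ^+ 2 + q ^+ 2 != 0 ->
  p * a - q * b = a -> p * b + q * a = b -> a = 0 /\ b = 0.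
Proof.
move=> pq0 Ea Eb; split; apply/eqP; rewrite -(mulrI_eq0 _ (mulfI pq0)).
- apply/eqP; transitivity ((p - 1) * (p * a - q * b - a) + q * (p * b + q * a - b)).
    by ring.
  by rewrite Ea Eb !subrr !mulr0 addr0.
- apply/eqP; transitivity ((p - 1) * (p * b + q * a - b) - q * (p * a - q * b - a)).
    by ring.
  by rewrite Ea Eb !subrr !mulr0 subr0.
Qed.

Lemma sigma3_fixed u v w (c y z : cayley C) :
  sigma3 R (u, v, w, c, y, z) = (u, v, w, c, y, z) ->
  [/\ c.1.1.1.1 = 0, c.1.1.1.2 = 0, y = 0 & z = 0].
Proof.
rewrite sigma3E.
have n1 : (- 2^-1 - 1) ^+ 2 + oy ^+ 2 != 0 :> C.
  rewrite omega_sq (_ : _ + _ = 3) ?complex3_neq0 //; by field.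
have n2 : (- 2^-1 - 1) ^+ 2 + (- oy) ^+ 2 != 0 :> C by rewrite sqrrN.
have h1 (a b : C) : - (2^-1 * a) - oy * b = a -> - (2^-1 * b) + oy * a = b ->
    a = 0 /\ b = 0.
  by rewrite -!(mulNr 2^-1); exact: (rotation_fixed0 n1).
have h2 (a b : C) : - (2^-1 * a) + oy * b = a -> - (2^-1 * b) - oy * a = b ->
    a = 0 /\ b = 0.
  by move=> Ea Eb; apply: (rotation_fixed0 n2); rewrite !mulNr ?opprK.
have s1 : (- 2^-1) ^+ 2 - oy ^+ 2 = - 2^-1 :> C by rewrite omega_sq; field.
have s2 : 2 * - 2^-1 * oy = - oy by rewrite mulrN mulfV ?two0 // mulN1r.
move: c y z => [[[[a b] c] d] [[[e f] g] k]]
  [[[[a' b'] c'] d'] [[[e' f'] g'] k']]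
  [[[[a'' b''] c''] d''] [[[e'' f''] g''] k'']].
move=> -[]; rewrite s1 s2 /=.
rewrite !mulNr opprK.
move=> /h1 hab {}/hab[-> ->] _ _ _ _ _ _.
move=> /h1 h {}/h[-> ->] /h1 h {}/h[-> ->] /h1 h {}/h[-> ->] /h2 h {}/h[-> ->].
move=> /h1 h {}/h[-> ->] /h2 h {}/h[-> ->] /h2 h {}/h[-> ->] /h1 h {}/h[-> ->].
by [].
Qed.

Lemma sigma3_fix_perp u v w c2 c3 q :
  let X := ((u, v, w, ((0, 0, c2, c3), q), 0, 0) : JC) in sigma3 R X = X.
Proof.
move: q => [[[c4 c5] c6] c7] X; rewrite sigma3E /X /= omega_norm.
apply: (congr6 erefl erefl erefl).
- by rewrite !mulr0 !mul1r addr0 subr0.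
- by apply: cayleyP; rewrite /= !mulr0 ?addr0 ?subr0.
- by apply: cayleyP; rewrite /= !mulr0 ?addr0 ?subr0.
Qed.

Lemma E6_fix_sigma3_comm f X : E6_fix (sigma3 R) f ->
  f (sigma3 R X) = sigma3 R (f X).
Proof.
move=> [_ fs]; rewrite -{2}fs -!lin_isoME.
by congr (_ X); rewrite !mulgA mulgV mul1g.
Qed.

Lemma scale_jE1 (k : C) : k *: (E1 : JC : lmodType C) = (k, 0, 0, 0, 0, 0).
Proof. by rewrite /jE1 jscaleE mulr1 !mulr0 !scaler0. Qed.

Lemma jtau0 : jtau 0 = 0 :> JC.
Proof. by rewrite /jtau /= /cayley_map /= !oppr0. Qed.

Lemma jtau_eq0 X : jtau X = 0 -> X = 0.
Proof. by move=> e; rewrite -[X]jtauK e jtau0. Qed.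

Lemma lin_iso_eq0 f X : f X = 0 -> X = 0.
Proof.
by move=> e; rewrite -[X](lin_isoK f) e; exact: (lin_iso0 (lin_isoV f)).
Qed.

Lemma sigma3_null f Z : E6_fix (sigma3 R) f -> sigma3 R Z = Z ->
  jcross (f E1) Z = 0 -> exists k : C, Z = k *: (f E1 : JC : lmodType C).
Proof.
move=> fs Zs; have [fE _] := fs.
have [W ZW] : exists W, Z = f W by exists (lin_isoV f Z); rewrite lin_isoVK.
rewrite {}ZW in Zs *.
rewrite E6_cross // => /jtau_eq0/lin_iso_eq0/jtau_eq0.
have {Zs} : sigma3 R W = W.
  by apply: (can_inj (lin_isoK f)); rewrite E6_fix_sigma3_comm.
move: W => [[[[[u v] w] x] y] z] /sigma3_fixed[_ _ -> ->].
rewrite jcross_jE1 // => e.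
have half0 : (2^-1 : C) != 0 by rewrite invr_eq0 two0.
have w0 : w = 0.
  by apply: (mulfI half0); rewrite mulr0; exact: (congr1 (fun X => X.1.1.1.1.2) e).
have v0 : v = 0.
  by apply: (mulfI half0); rewrite mulr0; exact: (congr1 (fun X => X.1.1.1.2) e).
have x0 : x = 0.
  have : - (2^-1 : C) *: x = 0 by exact: (congr1 (fun X => X.1.1.2) e).
  by move/eqP; rewrite scaler_eq0 oppr_eq0 (negPf half0) => /eqP.
exists u; rewrite -lin_isoZ scale_jE1 w0 v0 x0.
by [].
Qed.

Lemma jcross_self_eq0 (u v w : C) (x : cayley C) : u != 0 ->
  jcross (u, v, w, x, 0, 0) (u, v, w, x, 0, 0) = 0 ->
  [/\ v = 0, w = 0 & x = 0].
Proof.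
move=> u0; rewrite (jcrossE two0) !cmul0l !addr0 !cconj0 !cdot0x => e.
have E (a : C) : 2^-1 * (u * a + a * u - 2 * 0) = 0 -> a = 0.
  rewrite (_ : 2^-1 * _ = u * a); last by field.
  by move/eqP; rewrite mulf_eq0 (negPf u0) => /eqP.
split.
- exact: (E v (congr1 (fun X => X.1.1.1.2) e)).
- exact: (E w (congr1 (fun X => X.1.1.1.1.2) e)).
- have : (2^-1 : C) *: (0 - u *: x - u *: x) = 0 :=
    congr1 (fun X => X.1.1.2) e.
  rewrite sub0r -!scaleNr -scalerDl scalerA (_ : 2^-1 * _ = - u); last by field.
  by move/eqP; rewrite scaler_eq0 oppr_eq0 (negPf u0) => /eqP.
Qed.

Lemma jcross_jF1_eq0 (v w : C) (x c : cayley C) : cdot c x = 0 ->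
  jcross (0, v, w, x, 0, 0) (jF1 c) = 0.
Proof.
move=> cx0; rewrite (jcrossC two0) (jcross_jF1 two0) cx0 cmul0l cmul0r mulr0.
by rewrite cconj0 !scaler0 !oppr0 scale0r.
Qed.

(* [f E1] is sigma3-fixed and [f E1 x f E1 = 0], so it is a multiple of [E1] unless
   its [xi1] vanishes. In that case it annihilates a whole hyperplane of elements
   [F1(x)] fixed by sigma3, against [sigma3_null]. *)
Lemma E6_sigma3_jE1 f : E6_fix (sigma3 R) f ->
  exists k : C, f E1 = k *: (E1 : JC : lmodType C).
Proof.
move=> fs; have [fE _] := fs.
have Y0 : f E1 <> 0.
  move/lin_iso_eq0 => e; have := oner_neq0 C.
  by rewrite (congr1 (fun X => X.1.1.1.1.1) e : (1 : C) = 0) eqxx.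
have null := sigma3_null fs.
have Ys : sigma3 R (f E1) = f E1.
  by rewrite -E6_fix_sigma3_comm // [sigma3 R E1]sigma3_fix_perp.
have YY : jcross (f E1) (f E1) = 0.
  rewrite E6_cross // /jE1 jcross_jE1 // !mulr0 scaler0 jtau0.
  by rewrite (lin_iso0 f) jtau0.
move: (f E1) Y0 null Ys YY => [[[[[u v] w]
  [[[[c0 c1] c2] c3] [[[c4 c5] c6] c7]]] y] z] Y0 null.
move=> /sigma3_fixed[/= c00 c10 y0 z0]; rewrite {}c00 {}c10 {}y0 {}z0 in Y0 null *.
have [u0 | u0] := eqVneq u 0; last first.
  move=> /(jcross_self_eq0 u0)[-> -> ->].
  by exists u; rewrite scale_jE1.
move=> _; exfalso; rewrite {}u0 in null.
have {}null (a2 a3 a4 : C) : a2 * c2 + a3 * c3 + a4 * c4 = 0 ->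
    exists k : C, [/\ a2 = k * c2, a3 = k * c3 & a4 = k * c4].
  move=> a0; have := null (jF1 ((0, 0, a2, a3), (a4, 0, 0, 0))).
  rewrite sigma3_fix_perp jcross_jF1_eq0; last first.
    by rewrite /cdot /= !mul0r !addr0 !add0r.
  case=> // k e; exists k; split.
  - exact: (congr1 (fun X => X.1.1.2.1.1.2) e).
  - exact: (congr1 (fun X => X.1.1.2.1.2) e).
  - exact: (congr1 (fun X => X.1.1.2.2.1.1.1) e).
have one0 := oner_neq0 C.
have [c40 | c40] := eqVneq c4 0.
  have [|k [_ _ e]] := null 0 0 1; first by rewrite c40 !mul0r mulr0 !addr0.
  by rewrite e c40 mulr0 eqxx in one0.
have [|k [e2 e3 e4]] := null c3 (- c2) 0; first by ring.
have k0 : k = 0 by apply: (mulIf c40); rewrite -e4 mul0r.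
rewrite k0 !mul0r in e2 e3.
have c20 : c2 = 0 by rewrite -[c2]opprK e3 oppr0.
have [|l [e _ _]] := null 1 0 0; first by rewrite c20 !mul0r mulr0 !addr0.
by rewrite e c20 mulr0 eqxx in one0.
Qed.

End Sigma3.

Section Decomposition.
Variable R : realType.
Local Notation C := R[i].
Local Notation JC := (jordan C).
Local Notation JV := (jordan C : lmodType C).
Implicit Types (X Y Z : JC) (z t : U1 R) (f g : lin_iso JC).

Local Notation E1 := (jE1 C).
Local Notation A0 := (jF1 (scal_cayley (1 : C))).
Local Notation A1 := (jF1 (cayley_e1 C)).
Local Notation two0 := (complex2_neq0 R).
Local Notation cx z := ((complex.Re z)%:C).
Local Notation cy z := ((complex.Im z)%:C).
Local Notation ii := ('i%C : C).
Local Notation oy := ((Num.sqrt 3 / 2 : R)%:C).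

(* For [e = i] and [e = - i] these span [F_1(C)] and are the common
   eigenvectors of the rotations [D_a] there. *)
Definition axis (e : C) : JC := jF1 ((1, e, 0, 0), 0).

Lemma scale_axis (k e : C) :
  k *: (axis e : JV) = (0, 0, 0, ((k, k * e, 0, 0), 0), 0, 0).
Proof.
rewrite /axis /jF1 jscaleE !mulr0 !scaler0; apply: (congr6 erefl erefl erefl) => //.
by apply: cayleyP; rewrite /= /GRing.scale /= /GRing.scale /= ?mulr0 ?mulr1.
Qed.

Lemma rot_axis (x y e : C) : e ^+ 2 = -1 ->
  jrot x y (axis e) = (x + y * e) ^+ 2 *: (axis e : JV).
Proof.
move=> e2; rewrite scale_axis; apply: (congr6 erefl erefl erefl).
- apply: cayleyP; rewrite /= ?mulr0 //.
    rewrite (_ : _ ^+ 2 = x ^+ 2 + 2 * x * y * e + y ^+ 2 * e ^+ 2); last by ring.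
    by rewrite e2; ring.
  rewrite (_ : _ ^+ 2 * e =
    x ^+ 2 * e + 2 * x * y * e ^+ 2 + y ^+ 2 * e ^+ 2 * e); last by ring.
  by rewrite e2; ring.
- by apply: cayleyP; rewrite /= !mulr0 ?addr0 ?subr0.
- by apply: cayleyP; rewrite /= !mulr0 ?addr0 ?subr0.
Qed.

Lemma U1_complexE z : cx z + cy z * ii = z.
Proof. by case: z => [[x y] zP]; rewrite mulrC rcDi_subproof. Qed.

Lemma U1_complexVE z : cx z + cy z * - ii = (z : C)^-1.
Proof.
rewrite -U1_conj mulrN mulrC -mulrN -rmorphN.
by case: z => [[x y] zP]; rewrite rcDi_subproof.
Qed.

Lemma i2 : ii ^+ 2 = -1 :> C. Proof. exact: sqr_i. Qed.
Lemma Ni2 : (- ii) ^+ 2 = -1 :> C. Proof. by rewrite sqrrN sqr_i. Qed.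

Lemma Dz_axis z : Dz z (axis ii) = (z : C) ^+ 2 *: (axis ii : JV).
Proof. by rewrite DzE (rot_axis _ _ i2) U1_complexE. Qed.

Lemma Dz_axisN z : Dz z (axis (- ii)) = (z : C) ^- 2 *: (axis (- ii) : JV).
Proof. by rewrite DzE (rot_axis _ _ Ni2) U1_complexVE exprVn. Qed.

Lemma phi_axis t e : phi_iso t (axis e) = (t : C) ^- 2 *: (axis e : JV).
Proof.
rewrite /axis /jF1 jscaleE.
by apply: congr6 => //=; rewrite ?mulr0 ?scaler0.
Qed.

Lemma phi_jE1 t : phi_iso t E1 = (t : C) ^+ 4 *: (E1 : JV).
Proof. by rewrite scale_jE1 /= mulr1 !mulr0 !scaler0. Qed.

Lemma A0_axis : A0 = 2^-1 *: ((axis ii : JV) + axis (- ii)).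
Proof.
rewrite /axis /jF1 jaddE jscaleE !addr0 !mulr0 !scaler0.
apply: congr6 => //; apply: cayleyP; rewrite /= /GRing.scale /= /GRing.scale /=.
all: by rewrite ?addr0 ?subrr ?mulr0 // -mulr2n mulVf ?two0.
Qed.

Lemma A1_axis : A1 = (2 * ii)^-1 *: ((axis ii : JV) - axis (- ii)).
Proof.
have i0 : ii != 0 by rewrite -sqrf_eq0 i2 oppr_eq0 oner_neq0.
rewrite /axis /jF1 joppE jaddE jscaleE !subr0 !mulr0 !scaler0.
apply: congr6 => //; apply: cayleyP; rewrite /= /GRing.scale /= /GRing.scale /=.
all: rewrite ?subr0 ?subrr ?mulr0 //.
by rewrite opprK -mulr2n -mulr_natl; field; rewrite ?two0 ?i0.
Qed.

Lemma axis_A e : axis e = (A0 : JV) + e *: (A1 : JV).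
Proof.
rewrite /axis /jF1 jscaleE jaddE !mulr0 !scaler0 !addr0.
apply: congr6 => //; apply: cayleyP; rewrite /= /GRing.scale /= /GRing.scale /=.
all: by rewrite ?mulr0 ?addr0 ?mulr1 ?add0r.
Qed.

Lemma sigma3_axis e : e ^+ 2 = -1 ->
  sigma3 R (axis e) = (- 2^-1 - oy * e) *: (axis e : JV).
Proof.
move=> e2; rewrite sigma3E (rot_axis _ _ e2).
have -> : (- 2^-1 + oy * e) ^+ 2 = - 2^-1 - oy * e; last by [].
rewrite (_ : _ ^+ 2 = 4^-1 - oy * e + oy ^+ 2 * e ^+ 2); last by field.
by rewrite e2 omega_sq; field.
Qed.

Lemma sigma3_eigen e v w (c : cayley C) : e ^+ 2 = -1 ->
  sigma3 R (0, v, w, c, 0, 0) =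
    (- 2^-1 - oy * e) *: ((0, v, w, c, 0, 0) : JV) ->
  ((0, v, w, c, 0, 0) : JC) = c.1.1.1.1 *: (axis e : JV).
Proof.
move=> e2; set mu := - 2^-1 - oy * e.
have mu1 : mu - 1 != 0.
  apply/eqP => mu1; have := complex3_neq0 R.
  have <- : (mu - 1) * (- 2^-1 + oy * e - 1) = 3.
    rewrite /mu (_ : _ * _ = 9 / 4 - oy ^+ 2 * e ^+ 2); last by field.
    by rewrite e2 omega_sq; field.
  by rewrite mu1 mul0r eqxx.
have kill (a : C) : a = mu * a -> a = 0.
  move=> /eqP; rewrite eq_sym -subr_eq0 -{2}[a]mul1r -mulrBl mulf_eq0.
  by rewrite (negPf mu1) => /eqP.
rewrite sigma3E jscaleE scale_axis.
move: c => [[[[a b] c] d] [[[p q] g] k]] /=; rewrite omega_norm !mul1r.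
rewrite (_ : (- 2^-1) ^+ 2 - oy ^+ 2 = - 2^-1); last by rewrite omega_sq; field.
rewrite (_ : 2 * - 2^-1 * oy = - oy); last by rewrite mulrN mulfV ?two0 // mulN1r.
move=> E.
have -> := kill v (congr1 (fun X => X.1.1.1.1.2) E).
have -> := kill w (congr1 (fun X => X.1.1.1.2) E).
have -> := kill c (congr1 (fun X => X.1.1.2.1.1.2) E).
have -> := kill d (congr1 (fun X => X.1.1.2.1.2) E).
have -> := kill p (congr1 (fun X => X.1.1.2.2.1.1.1) E).
have -> := kill q (congr1 (fun X => X.1.1.2.2.1.1.2) E).
have -> := kill g (congr1 (fun X => X.1.1.2.2.1.2) E).
have -> := kill k (congr1 (fun X => X.1.1.2.2.2) E).
have ab : - 2^-1 * a + - oy * b = mu * a := congr1 (fun X => X.1.1.2.1.1.1.1) E.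
have y0 : oy != 0.
  by rewrite -sqrf_eq0 omega_sq mulf_neq0 ?invr_eq0 ?pnatr_eq0.
have -> // : b = a * e.
apply: (mulfI y0); move: ab; rewrite /mu mulrBl => /addrI.
by rewrite mulNr => /oppr_inj ->; ring.
Qed.

End Decomposition.

Section Surjectivity.
Variable R : realType.
Local Notation C := R[i].
Local Notation JC := (jordan C).
Local Notation JV := (jordan C : lmodType C).
Implicit Types (X Y Z : JC) (z t : U1 R) (f g : lin_iso JC).

Local Notation E1 := (jE1 C).
Local Notation A0 := (jF1 (scal_cayley (1 : C))).
Local Notation A1 := (jF1 (cayley_e1 C)).
Local Notation two0 := (complex2_neq0 R).
Local Notation ii := ('i%C : C).

Lemma E6_dot_cross f X Y Z : E6 f ->
  jdot (jcross (f X) (f Y)) (f Z) = jdot (jcross X Y) Z.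
Proof.
move=> fE; have [_ fherm] := fE.
rewrite (E6_cross X Y fE); apply: etrans (fherm (jtau (jcross X Y)) Z) _.
by rewrite /jherm jtauK.
Qed.

Lemma jcross_jE1_axis e :
  jcross E1 (axis e) = (- 2^-1 : C) *: (axis e : JV).
Proof.
rewrite (jcross_jE1 two0) /axis /jF1 jscaleE.
by rewrite !mulr0 scaler0.
Qed.

Lemma jdot_axis (e k : C) : jdot (axis e) (axis k) = 2 * (1 + e * k).
Proof.
by rewrite /axis (jdot_jF1 two0) /cdot /= !mulr0 mulr1 !addr0.
Qed.

Lemma jtau_axis (e : C) : jtau (axis e) = axis (conjc e).
Proof.
have c0 : conjc (0 : C) = 0 by rewrite rmorph0.
have c1 : conjc (1 : C) = 1 by rewrite rmorph1.
apply: (congr6 c0 c0 c0).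
- by apply: cayleyP; [exact: c1 | | exact: c0 ..].
- by apply: cayleyP; exact: c0.
- by apply: cayleyP; exact: c0.
Qed.

Definition peirce0 X := [/\ X.1.1.1.1.1 = 0, X.1.2 = 0 & X.2 = 0].

Lemma peirce0_scale (k : C) X : peirce0 X -> peirce0 (k *: (X : JV)).
Proof.
move: X => [[[[[u v] w] x] y] z] [/= -> -> ->].
by rewrite jscaleE; split; rewrite /= ?mulr0 ?scaler0.
Qed.

Lemma peirce0_jtau X : peirce0 X -> peirce0 (jtau X).
Proof.
move: X => [[[[[u v] w] x] y] z] [/= -> -> ->].
by split; rewrite /= ?oppr0 // /cayley_map /= !oppr0.
Qed.

Lemma peirce0_jE1 X : peirce0 (jcross E1 X).
Proof. by move: X => [[[[[u v] w] x] y] z]; rewrite (jcross_jE1 two0). Qed.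

Lemma E6_axis f (u e : C) : E6_fix (sigma3 R) f -> f E1 = u *: (E1 : JV) ->
  e ^+ 2 = -1 -> exists l : C, f (axis e) = l *: (axis e : JV).
Proof.
move=> fs fe e2; have [fE _] := fs.
have shape : peirce0 (f (axis e)).
  have -> : axis e = (- 2 : C) *: (jcross E1 (axis e) : JV).
    by rewrite jcross_jE1_axis scalerA mulrNN mulfV ?two0 // scale1r.
  rewrite (lin_isoZ f) (E6_cross_inv _ _ fE) jtau_jE1 fe (jcrossZl two0).
  apply: peirce0_scale; apply: peirce0_jtau; apply: peirce0_scale.
  exact: peirce0_jE1.
have := E6_fix_sigma3_comm (axis e) fs; rewrite sigma3_axis // (lin_isoZ f).
move: (f (axis e)) shape => [[[[[p v] w] c] y] z] [/= -> -> ->].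
by move=> /esym/(sigma3_eigen e2) E; exists c.1.1.1.1.
Qed.

Lemma E6_fix_sigma3_axes f : E6_fix (sigma3 R) f -> exists u l m : U1 R,
  [/\ f E1 = (u : C) *: (E1 : JV), f (axis ii) = (l : C) *: (axis ii : JV),
      f (axis (- ii)) = (m : C) *: (axis (- ii) : JV) & (u : C) * l * m = 1].
Proof.
move=> fs; have [fE _] := fs; have [_ fherm] := fE.
have [u fe] := E6_sigma3_jE1 fs.
have [l fl] := E6_axis fs fe (i2 R).
have [m fm] := E6_axis fs fe (Ni2 R).
have unit (k : C) X : f X = k *: (X : JV) -> jherm X X != 0 -> conjc k * k == 1.
  move=> fk X0; apply/eqP; apply: (mulIf X0); rewrite mul1r -[RHS]fherm fk /jherm.
  by rewrite jtauZ (jdotZl two0) (jdotZr two0) mulrA.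
have axis0 (e : C) : e ^+ 2 = -1 -> conjc e = - e -> jherm (axis e) (axis e) != 0.
  move=> e2 ce; have -> : jherm (axis e) (axis e) = 4.
    rewrite /jherm jtau_axis ce.
    by rewrite jdot_axis mulNr -expr2 e2; ring.
  by rewrite pnatr_eq0.
have ci : conjc ii = - ii.
  by rewrite -[LHS]/(Complex _ _) -[RHS]/(Complex _ _) /= oppr0.
have u1 : conjc u * u == 1.
  apply: (unit u E1 fe); rewrite /jherm jtau_jE1 jdot_jE1 //; exact: oner_neq0.
have l1 : conjc l * l == 1 by apply: (unit l _ fl); apply: axis0; [exact: i2 |].
have m1 : conjc m * m == 1.
  by apply: (unit m _ fm); apply: axis0;
    [exact: Ni2 | rewrite rmorphN; exact: (congr1 (fun x => - x) ci)].
exists (MkU1 u1), (MkU1 l1), (MkU1 m1); split=> //=.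
have d0 : jdot (jcross E1 (axis ii)) (axis (- ii)) = - 2.
  rewrite jcross_jE1_axis (jdotZl two0) jdot_axis mulrN -expr2 i2.
  by field.
have N20 : (- 2 : C) != 0 by rewrite oppr_eq0 two0.
apply: (mulIf N20); rewrite mul1r -[RHS]d0 -[RHS](E6_dot_cross _ _ _ fE).
rewrite fe fl fm (jcrossZl two0) (jcrossC two0) (jcrossZl two0) (jcrossC two0).
by rewrite 2!(jdotZl two0) (jdotZr two0) d0; ring.
Qed.

Lemma axis_fixed_Spin8 f : E6 f -> f (jE1 C) = jE1 C ->
  f (axis 'i%C) = axis 'i%C -> f (axis (- 'i%C)%R) = axis (- 'i%C)%R -> Spin8 f.
Proof.
move=> fE fe fl fm; split=> //.
- by rewrite A0_axis (lin_isoZ f) (lin_isoD f) fl fm.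
- by rewrite A1_axis (lin_isoZ f) (lin_isoD f) (lin_isoN f) fl fm.
Qed.

Lemma Spin8_residue f (u l m t z : U1 R) : E6 f ->
  f E1 = (u : C) *: (E1 : JV) -> f (axis ii) = (l : C) *: (axis ii : JV) ->
  f (axis (- ii)) = (m : C) *: (axis (- ii) : JV) -> (u : C) * l * m = 1 ->
  (t : C) ^+ 4 = u -> (z : C) ^+ 2 = (t : C) ^+ 2 * l ->
  Spin8 (Dz z^-1 * (phi_iso t^-1 * f))%g.
Proof.
move=> fE fe fl fm ulm t4 z2.
have [_ E6M _] := E6_subgroup R.
set g := (_ * _)%g.
have gE : E6 g := E6M _ _ (Dz_E6 _) (E6M _ _ (phi_E6 _) fE).
have t0 := U1_neq0 t; have z0 := U1_neq0 z; have l0 := U1_neq0 l.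
have V (s : U1 R) : (s^-1%g : C) = (s : C)^-1 by rewrite -U1_conj.
have ge : g E1 = E1.
  rewrite !lin_isoME fe (lin_isoZ (phi_iso _)) phi_jE1 scalerA V exprVn t4.
  by rewrite mulfV ?U1_neq0 // scale1r Dz_jE1.
have gl : g (axis ii) = axis ii.
  rewrite !lin_isoME fl (lin_isoZ (phi_iso _)) phi_axis scalerA.
  rewrite (lin_isoZ (Dz _)) Dz_axis scalerA !V !exprVn invrK z2.
  rewrite (_ : _ * _ = 1) ?scale1r //.
  by move: (t : C) (l : C) t0 l0 => a b a0 b0; field; rewrite a0 b0.
have gm : g (axis (- ii)) = axis (- ii).
  rewrite !lin_isoME fm (lin_isoZ (phi_iso _)) phi_axis scalerA.
  rewrite (lin_isoZ (Dz _)) Dz_axisN scalerA !V !exprVn !invrK z2.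
  rewrite (_ : _ * _ = 1) ?scale1r // -ulm -t4.
  by ring.
exact: axis_fixed_Spin8.
Qed.

Lemma spin_residueK f t z :
  (phi_iso t * Dz z * (Dz z^-1 * (phi_iso t^-1 * f)))%g = f.
Proof. by rewrite DzV phiV !mulgA mulgK mulgV mul1g. Qed.

Lemma Spin8_axis f e : Spin8 f -> f (axis e) = axis e.
Proof.
move=> [_ _ f0 f1].
by rewrite axis_A (lin_isoD f) (lin_isoZ f) f0 f1.
Qed.

Lemma spin_product_jE1 t z f : Spin8 f ->
  (phi_iso t * Dz z * f)%g E1 = (t : C) ^+ 4 *: (E1 : JV).
Proof. by case=> _ fe _ _; rewrite !lin_isoME fe Dz_jE1 phi_jE1. Qed.

Lemma spin_product_axis t z f : Spin8 f ->
  (phi_iso t * Dz z * f)%g (axis ii) =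
  ((t : C) ^- 2 * (z : C) ^+ 2) *: (axis ii : JV).
Proof.
move=> fS; rewrite !lin_isoME Spin8_axis // Dz_axis (lin_isoZ (phi_iso t)).
by rewrite phi_axis scalerA mulrC.
Qed.

Lemma scale_jE1_inj (k l : C) : k *: (E1 : JV) = l *: (E1 : JV) -> k = l.
Proof. by rewrite !scale_jE1 => -[]. Qed.

Lemma scale_axis_inj (k l e : C) :
  k *: (axis e : JV) = l *: (axis e : JV) -> k = l.
Proof. by rewrite !scale_axis => -[]. Qed.

Lemma spin_product_eq1 t z f : Spin8 f -> (phi_iso t * Dz z * f = 1)%g ->
  (t : C) ^+ 4 = 1 /\ (z : C) ^+ 2 = (t : C) ^+ 2.
Proof.
move=> fS p1; split.
  apply: scale_jE1_inj; rewrite -(spin_product_jE1 t z fS) p1 scale1r.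
  exact: lin_iso1E.
have : (t : C) ^- 2 * (z : C) ^+ 2 = 1.
  apply: (@scale_axis_inj _ _ ii); rewrite -(spin_product_axis t z fS) p1 scale1r.
  exact: lin_iso1E.
have t0 : (t : C) ^+ 2 != 0 by rewrite expf_neq0 ?U1_neq0.
by move=> e; apply: (mulfI (invr_neq0 t0)); rewrite e mulVf.
Qed.

End Surjectivity.

(** * The quotient group *)

Section FiniteCyclic.
Variable G : groupType.
Local Open Scope group_scope.

Definition powers (x : G) : set G := [set x ^+ n | n in [set: nat]].

Lemma powers_subgroup (x : G) k : x ^+ k.+1 = 1 -> subgroup (powers x).
Proof.
move=> xk; split.
- by exists 0%N.
- by move=> _ _ [m _ <-] [n _ <-]; exists (m + n)%N; rewrite ?expgnDr.
- move=> _ [m _ <-]; exists (m * k)%N => //.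
  by apply/esym/mulg1_eq; rewrite -expgnDr -mulnS mulnC expgnA xk expg1n.
Qed.

Lemma powersE (x : G) k : x ^+ k.+1 = 1 ->
  powers x = [set y | exists2 n, (n <= k)%N & y = x ^+ n].
Proof.
move=> xk; apply/seteqP; split=> y [n]; last by move=> _ ->; exists n.
move=> _ <-; exists (n %% k.+1)%N; first by rewrite -ltnS ltn_pmod.
by rewrite {1}(divn_eq n k.+1) expgnDr mulnC expgnA xk expg1n mul1g.
Qed.

End FiniteCyclic.

Section Kernel.
Variable R : realType.
Local Notation C := R[i].
Local Notation JC := (jordan C).
Local Notation L := (lin_iso JC).
Local Notation T := (U1 R * L * L)%type.
Implicit Types (z t : U1 R) (f g : L).
Local Open Scope group_scope.

Definition spin_product (x : T) : L := phi_iso x.1.1 * x.1.2 * x.2.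

Local Notation p := spin_product.
Local Notation G := (@U1_Spin2_Spin8 R).

Lemma U1P_spin x : G x <-> exists t z b, [/\ Spin8 b & x = (t, Dz z, b)].
Proof.
split=> [|[t [z [b [bS ->]]]]].
  move: x => [[t d] b] [[_ /Spin2P[z /= ->]] bS].
  by exists t, z, b.
by split=> //; split=> //; apply/Spin2P; exists z.
Qed.

Lemma G_subgroup : subgroup G.
Proof.
have [S1 SM SV] := Spin8_subgroup R.
split.
- by apply/U1P_spin; exists 1, 1, 1; split; [exact: S1 | rewrite Dz1].
- move=> _ _ /U1P_spin[t [z [b [bS ->]]]] /U1P_spin[t' [z' [b' [bS' ->]]]].
  apply/U1P_spin; exists (t * t'), (z * z'), (b * b'); split.
    exact: (SM _ _ bS bS').
  by rewrite DzM.
- move=> _ /U1P_spin[t [z [b [bS ->]]]].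
  apply/U1P_spin; exists t^-1, z^-1, b^-1; split; first exact: (SV _ bS).
  by rewrite DzV.
Qed.

Lemma spin_productM x y : G x -> G y -> p (x * y) = p x * p y.
Proof.
move=> /U1P_spin[t [z [b [bS ->]]]] /U1P_spin[t' [z' [b' [bS' ->]]]].
have [bE be _ _] := bS.
rewrite /p /= phiM !mulgA; congr (_ * _).
rewrite -!mulgA; congr (_ * _).
rewrite (mulgA b) (E6_jE1_phi t' bE be) -(mulgA _ b) (Spin8_Dz z' bS).
by rewrite [RHS]mulgA Dz_phi -!mulgA.
Qed.

Lemma E6_fixE g f : E6_fix g f <-> E6 f /\ g * f = f * g.
Proof.
split=> -[fE fg]; split=> //.
  by rewrite -{1}fg !mulgA mulgV mul1g.
by rewrite -mulgA -fg mulgA mulVg mul1g.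
Qed.

Lemma spin_product_E6 x : G x -> E6 (p x).
Proof.
have [_ E6M _] := E6_subgroup R.
move=> /U1P_spin[t [z [b [[bE _ _ _] ->]]]].
exact: (E6M _ _ (E6M _ _ (phi_E6 t) (Dz_E6 z)) bE).
Qed.

Lemma phiC s t : phi_iso s * phi_iso t = phi_iso t * phi_iso s :> L.
Proof.
rewrite -!phiM; congr phi_iso; apply/val_inj; exact: (mulrC (s : C) (t : C)).
Qed.

Lemma DzC w z : Dz w * Dz z = Dz z * Dz w :> L.
Proof.
rewrite -!DzM; congr Dz; apply/val_inj; exact: (mulrC (w : C) (z : C)).
Qed.

Lemma spin_product_phi s x : G x -> E6_fix (phi_iso s) (p x).
Proof.
move=> Gx; apply/E6_fixE; split; first exact: spin_product_E6.
move: Gx => /U1P_spin[t [z [b [[bE be _ _] ->]]]].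
rewrite /p /= !mulgA phiC -!mulgA; congr (_ * _).
by rewrite mulgA -Dz_phi -!mulgA (E6_jE1_phi s bE be).
Qed.

Lemma spin_product_Dz w x : G x -> E6_fix (Dz w) (p x).
Proof.
move=> Gx; apply/E6_fixE; split; first exact: spin_product_E6.
move: Gx => /U1P_spin[t [z [b [bS ->]]]].
rewrite /p /= !mulgA Dz_phi -!mulgA; congr (_ * _).
by rewrite mulgA DzC -!mulgA (Spin8_Dz w bS).
Qed.

Lemma U1_sqrt (w : U1 R) : exists z : U1 R, ((z : C) ^+ 2 = w)%R.
Proof.
have s2 := sqr_sqrtc (w : C).
move: (sqrtc _) s2 => s s2.
have k2 : ((conjc s * s) ^+ 2 = 1)%R.
  by rewrite exprMn -rmorphXn s2; apply/eqP/U1P.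
suff sP : (conjc s * s == 1)%R by exists (MkU1 sP).
move: k2 {s2}; case: s => a b /eqP; rewrite sqrf_eq1 => /orP[//|].
rewrite eq_complex /= => /andP[/eqP ab _].
have : (0 <= a * a - - b * b)%R by rewrite mulNr opprK addr_ge0 // -expr2 sqr_ge0.
by rewrite ab ler0N1.
Qed.

Lemma spin_lift f (u l m t z : U1 R) : E6 f ->
  f (jE1 C) = ((u : C) *: (jE1 C : JC : lmodType C))%R ->
  f (axis 'i%C) = ((l : C) *: (axis 'i%C : JC : lmodType C))%R ->
  f (axis (- 'i%C)%R) = ((m : C) *: (axis (- 'i%C) : JC : lmodType C))%R ->
  ((u : C) * l * m = 1)%R ->
  ((t : C) ^+ 4 = u)%R -> ((z : C) ^+ 2 = (t : C) ^+ 2 * l)%R ->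
  let x : T := (t, Dz z, Dz z^-1 * (phi_iso t^-1 * f)) in G x /\ p x = f.
Proof.
move=> fE fe fl fm ulm t4 z2 x; split; last exact: spin_residueK.
apply/U1P_spin; exists t, z; eexists; split; last exact: erefl.
exact: (Spin8_residue fE fe fl fm ulm t4 z2).
Qed.

Lemma spin_product_surj f : E6_fix (sigma3 R) f -> exists2 x, G x & p x = f.
Proof.
move=> fs; have [fE _] := fs.
have [u [l [m [fe fl fm ulm]]]] := E6_fix_sigma3_axes fs.
have [s s2] := U1_sqrt u; have [t t2] := U1_sqrt s.
have [z z2] := U1_sqrt (t * t * l).
have t4 : ((t : C) ^+ 4 = u)%R by rewrite -s2 -t2 -exprM.
have := spin_lift fE fe fl fm ulm t4 (z := z).
rewrite z2 -[((t * t * l)%g : C)]/(((t : C) * (t : C) * (l : C))%R) -expr2.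
by move=> /(_ erefl)[Gx px]; exists (t, Dz z, Dz z^-1 * (phi_iso t^-1 * f)).
Qed.

Lemma sigma3_Dz : exists w, sigma3 R = Dz w.
Proof. exact: unit_C_circ. Qed.

Lemma range_spin_product : [set p x | x in G] = E6_fix (sigma3 R).
Proof.
apply/seteqP; split=> [_ [x Gx <-] | f /spin_product_surj[x Gx <-]].
  by have [w ->] := sigma3_Dz; exact: spin_product_Dz.
by exists x.
Qed.

Lemma E6_fix_mu3_sigma3 :
  E6_fix (sigma3 R) `&` E6_fix (mu3 R) = E6_fix (sigma3 R).
Proof.
apply/setIidPl; rewrite -range_spin_product => _ [x Gx <-].
exact: spin_product_phi.
Qed.

End Kernel.

Section Quotients.
Variables (T L : groupType) (G : set T) (p : T -> L).
Hypotheses (GS : subgroup G)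
  (pM : forall x y, G x -> G y -> p (x * y)%g = (p x * p y)%g).
Local Open Scope group_scope.

Definition morph_kernel : set T := [set x | G x /\ p x = 1].

Lemma morph1 : p 1 = 1.
Proof.
have [G1 _ _] := GS; apply: (mulgI (p 1)).
by rewrite -pM // !mulg1.
Qed.

Lemma morphV x : G x -> p x^-1 = (p x)^-1.
Proof.
have [_ _ GV] := GS; move=> Gx; apply/esym/mulg1_eq.
by rewrite -(pM Gx (GV _ Gx)) mulgV morph1.
Qed.

Lemma kernel_normal : normal_subgroup morph_kernel G.
Proof.
have [G1 GM GV] := GS.
split=> //; last 2 first.
- by move=> x [].
- move=> x n Gx [Gn pn]; split; first exact: (GM _ _ (GM _ _ Gx Gn) (GV _ Gx)).
  by rewrite (pM (GM _ _ Gx Gn) (GV _ Gx)) (pM Gx Gn) pn mulg1 (morphV Gx) mulgV.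
split.
- by split=> //; exact: morph1.
- move=> x y [Gx px] [Gy py]; split; first exact: GM.
  by rewrite pM // px py mulg1.
- move=> x [Gx px]; split; first exact: GV.
  by rewrite morphV // px invg1.
Qed.

Lemma coset_kernel x y : G x -> coset_by morph_kernel x y <-> G y /\ p y = p x.
Proof.
have [G1 GM GV] := GS; move=> Gx; split.
  move=> [n [Gn pn] <-]; split; first exact: GM.
  by rewrite pM // pn mulg1.
move=> [Gy pyx]; exists (x^-1 * y); last by rewrite mulgA mulgV mul1g.
split; first exact: (GM _ _ (GV _ Gx) Gy).
by rewrite (pM (GV _ Gx) Gy) (morphV Gx) pyx mulVg.
Qed.

Lemma coset_kernel_self x : G x -> coset_by morph_kernel x x.
Proof. by move=> Gx; apply/coset_kernel. Qed.

Definition coset_morph (A : set T) : L := p (xget 1 A).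

Lemma coset_morphE x : G x -> coset_morph (coset_by morph_kernel x) = p x.
Proof.
move=> Gx; rewrite /coset_morph.
have : coset_by morph_kernel x (xget 1 (coset_by morph_kernel x)).
  exact: (xgetPex 1 (ex_intro _ x (coset_kernel_self Gx))).
by move/(coset_kernel _ Gx) => [].
Qed.

Lemma setmul_coset x y : G x -> G y ->
  setmul (coset_by morph_kernel x) (coset_by morph_kernel y) =
  coset_by morph_kernel (x * y).
Proof.
have [G1 GM GV] := GS; move=> Gx Gy; have Gxy := GM _ _ Gx Gy.
apply/seteqP; split=> w.
  move=> [x' /(coset_kernel _ Gx)[Gx' px] [y' /(coset_kernel _ Gy)[Gy' py] <-]].
  apply/(coset_kernel _ Gxy); split; first exact: GM.
  by rewrite !pM // px py.
move=> /(coset_kernel _ Gxy)[Gw pw]; exists x; first exact: coset_kernel_self.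
exists (x^-1 * w); last by rewrite mulgA mulgV mul1g.
apply/(coset_kernel _ Gy); have GVx := GV _ Gx; split; first exact: GM.
by rewrite (pM GVx Gw) (morphV Gx) pw (pM Gx Gy) mulgA mulVg mul1g.
Qed.

Lemma coset_morph_isomorphism (H : set L) : [set p x | x in G] = H ->
  quotient_isomorphism G morph_kernel H coset_morph.
Proof.
have [G1 GM GV] := GS; move=> <-; split; last first.
  move=> _ _ [x Gx <-] [y Gy <-].
  by rewrite (setmul_coset Gx Gy) !coset_morphE ?(pM Gx Gy) //; exact: GM.
split.
- by move=> _ [x Gx <-]; rewrite /= coset_morphE //; exists x.
- move=> _ _ /set_mem[x Gx <-] /set_mem[y Gy <-]; rewrite !coset_morphE // => pxy.
  apply/seteqP; split=> w.
    by move/(coset_kernel _ Gx)=> [Gw pw]; apply/(coset_kernel _ Gy); rewrite -pxy.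
  by move/(coset_kernel _ Gy)=> [Gw pw]; apply/(coset_kernel _ Gx); rewrite pxy.
- move=> _ [x Gx <-]; exists (coset_by morph_kernel x); first by exists x.
  exact: coset_morphE.
Qed.

End Quotients.

Section KernelOfSpinProduct.
Variable R : realType.
Local Notation C := R[i].
Local Notation JC := (jordan C).
Local Notation L := (lin_iso JC).
Local Notation T := (U1 R * L * L)%type.
Implicit Types (z t : U1 R) (f g : L).
Local Open Scope group_scope.

Local Notation p := (@spin_product R).
Local Notation G := (@U1_Spin2_Spin8 R).
Local Notation i1 := (U1_i R).
Local Notation n1 := (U1_opp (1 : U1 R)).

Lemma unit_C_DzE (x y : R) (h : (x ^+ 2 + y ^+ 2 = 1)%R) z :
  ((z : C) = x +i* y)%R -> D_iso (mk_unit_C h) = Dz z.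
Proof.
move=> zE; apply: lin_iso_eq => X.
by rewrite DzE zE -cext_rot /D_iso /= /cext !dmapE.
Qed.

Lemma sigmaE : sigma R = Dz n1.
Proof. by apply: unit_C_DzE; apply/eqP; rewrite eq_complex /= oppr0 !eqxx. Qed.

Lemma D_e1E : D_iso (unit_e1 R) = Dz i1.
Proof. exact: unit_C_DzE. Qed.

Lemma D_Ne1E : D_iso (unit_Ne1 R) = Dz (U1_opp i1).
Proof. by apply: unit_C_DzE; apply/eqP; rewrite eq_complex /= oppr0 !eqxx. Qed.

Lemma U1_eqP (s t : U1 R) : (s : C) = t -> s = t.
Proof. exact: val_inj. Qed.

Lemma i1_sq : i1 * i1 = n1.
Proof. by apply: U1_eqP; rewrite /= -expr2 sqr_i. Qed.

Lemma n1_sq : n1 * n1 = 1.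
Proof. by apply: U1_eqP; rewrite /= mulrNN mulr1. Qed.

Lemma opp_i1 : U1_opp i1 = i1 ^-1.
Proof.
apply/esym/mulg1_eq; apply: U1_eqP.
by rewrite /= mulrN -expr2 sqr_i opprK.
Qed.

Lemma phi_n1 : phi_iso n1 = Dz n1.
Proof.
apply: lin_iso_eq => X; rewrite DzE.
have E (V : lmodType C) (v : V) : ((-1 : C) *: v = - v)%R by rewrite scaleN1r.
move: X => [[[[[u v] w]
  [[[[a b] c] d] [[[e f] g] h]]]
  [[[[a' b'] c'] d'] [[[e' f'] g'] h']]]
  [[[[a'' b''] c''] d''] [[[e'' f''] g''] h'']]].
rewrite /phi_iso /phi_map /= oppr0 rmorphN rmorph1 rmorph0.
rewrite (_ : ((-1) ^+ 4 = 1)%R); last by rewrite -signr_odd.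
rewrite sqrrN expr1n invr1 !mul1r !scale1r !E.
apply: congr6 => //; apply: cayleyP; rewrite /=; ring.
Qed.

Local Notation s2 := ((1, sigma R, sigma R) : T).
Local Notation g4 := ((i1, Dz i1, phi_iso i1^-1 * Dz i1^-1) : T).

Lemma s2_sq : s2 ^+ 2 = 1.
Proof.
by rewrite expg2 /= sigmaE; congr (_, _, _); rewrite ?mulg1 // -DzM n1_sq Dz1.
Qed.

Lemma group_Z2E : @group_Z2 R = powers s2.
Proof.
rewrite (powersE s2_sq); apply/seteqP; split=> x.
  by case=> ->; [exists 0%N | exists 1%N].
by move=> [[|[|//]] _ ->]; [left | right].
Qed.

Lemma g4_sq : g4 * g4 = (n1, sigma R, 1).
Proof.
rewrite sigmaE; congr (_, _, _); rewrite /=.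
- exact: i1_sq.
- by rewrite -DzM i1_sq.
- rewrite mulgA -(mulgA (phi_iso _) (Dz _)) Dz_phi mulgA -phiM -mulgA -DzM.
  rewrite -invgM i1_sq phiV DzV phi_n1 -invgM -DzM n1_sq Dz1.
  by rewrite invg1.
Qed.

Lemma g4_cube : g4 * (g4 * g4) = (i1^-1, Dz i1^-1, phi_iso i1 * Dz i1).
Proof.
have n1V : n1^-1 = n1 by apply: mulg1_eq; rewrite n1_sq.
have i1n1 : i1 * n1 = i1^-1.
  by rewrite -n1V -i1_sq invgM mulgA mulgV mul1g.
rewrite g4_sq sigmaE; congr (_, _, _) => /=.
- exact: i1n1.
- by rewrite -DzM i1n1.
- have i1E : i1 = i1^-1 * n1 by rewrite -i1_sq mulgA mulVg mul1g.
  rewrite mulg1 {3 4}i1E phiM DzM phi_n1 -mulgA; congr (_ * _).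
  rewrite [Dz i1^-1 * _]DzC mulgA.
  by rewrite -(DzM n1) n1_sq Dz1 mul1g.
Qed.

Lemma g4_pow4 : g4 ^+ 4 = 1.
Proof.
rewrite -[4%N]/(2 * 2)%N expgnA !expg2 g4_sq sigmaE.
by congr (_, _, _); rewrite /= ?mulg1 ?n1_sq // -DzM n1_sq Dz1.
Qed.

Lemma group_Z4E : @group_Z4 R = powers g4.
Proof.
have e1 : ((i1, D_iso (unit_e1 R), phi_iso (U1_opp i1) * D_iso (unit_Ne1 R)) : T)
    = g4.
  by rewrite D_e1E D_Ne1E opp_i1.
have e3 : ((U1_opp i1, D_iso (unit_Ne1 R), phi_iso i1 * D_iso (unit_e1 R)) : T)
    = g4 * (g4 * g4).
  by rewrite D_e1E D_Ne1E opp_i1 g4_cube.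
rewrite (powersE g4_pow4) /group_Z4 e1 e3 -g4_sq.
apply/seteqP; split=> x.
  case=> [[[->|->]|->]|->]; [exists 0%N | exists 1%N | exists 2%N | exists 3%N] => //.
move=> [[|[|[|[|//]]]] _ ->].
all: by [left; left; left | left; left; right | left; right | right].
Qed.

End KernelOfSpinProduct.

Section KernelIdentification.
Variable R : realType.
Local Notation C := R[i].
Local Notation JC := (jordan C).
Local Notation L := (lin_iso JC).
Local Notation T := (U1 R * L * L)%type.
Implicit Types (z t : U1 R) (f g : L).
Local Open Scope group_scope.

Local Notation p := (@spin_product R).
Local Notation G := (@U1_Spin2_Spin8 R).
Local Notation i1 := (U1_i R).
Local Notation n1 := (U1_opp (1 : U1 R)).
Local Notation s2 := ((1, sigma R, sigma R) : T).
Local Notation g4 := ((i1, Dz i1, phi_iso i1^-1 * Dz i1^-1) : T).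

Lemma i1_neq1 : i1 <> 1.
Proof.
move=> /(congr1 (fun z : U1 R => complex.Re (z : C))) /= /eqP.
by rewrite eq_sym oner_eq0.
Qed.

Lemma i1n_eq1 n : (n <= 3)%N -> i1 ^+ n = 1 -> n = 0%N.
Proof.
case: n => [//|[|[|[|//]]]] _ e; exfalso.
- exact: (i1_neq1 e).
- move: e; rewrite expg2 i1_sq.
  move=> /(congr1 (fun z : U1 R => complex.Re (z : C))) /= /eqP.
  by rewrite -subr_eq0 -opprD oppr_eq0 -[(1 + 1)%R]/(2%:R) pnatr_eq0.
- apply: i1_neq1; apply: (mulgI (i1 * i1 * i1)); rewrite mulg1.
  have e3 : i1 * i1 * i1 = 1 by rewrite -mulgA -expg2 -expgS.
  have : i1 * i1 * i1 * i1 = 1 by rewrite -mulgA i1_sq n1_sq.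
  by rewrite e3 mul1g.
Qed.

Lemma s2_g4_comm : commute s2 g4.
Proof.
rewrite /commute; congr (_, _, _); rewrite /= ?mulg1 ?mul1g //; rewrite sigmaE.
  by rewrite DzC.
by rewrite mulgA Dz_phi -mulgA DzC mulgA.
Qed.

Lemma g4n_fst n : ((g4 ^+ n).1.1 = i1 ^+ n) * ((g4 ^+ n).1.2 = Dz (i1 ^+ n)).
Proof.
elim: n => [|n [IH1 IH2]]; first by rewrite !expg0 Dz1.
by rewrite !expgS /= IH1 IH2 DzM.
Qed.

Lemma Z2_Z4_direct : direct_subgroups (@group_Z2 R) (@group_Z4 R).
Proof.
split.
- by rewrite group_Z2E; apply: powers_subgroup (s2_sq R).
- by rewrite group_Z4E; apply: powers_subgroup (g4_pow4 R).
- rewrite group_Z2E group_Z4E => _ _ [m _ <-] [n _ <-].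
  exact: (commuteX2 m n s2_g4_comm).
- apply/seteqP; split=> [x [] | _ ->]; last by split; left=> //; left; left.
  rewrite group_Z4E (powersE (g4_pow4 R)).
  case=> -> // [n n3 e]; rewrite e.
  have := congr1 (fun x : T => x.1.1) e.
  by rewrite g4n_fst /= => /esym/(i1n_eq1 n3) ->.
Qed.

Lemma Spin8_phi_Dz t z : ((t : C) ^+ 4 = 1)%R -> ((z : C) ^+ 2 = (t : C) ^+ 2)%R ->
  Spin8 (phi_iso t * Dz z).
Proof.
move=> t4 zt; have [_ E6M _] := E6_subgroup R.
have t0 : ((t : C) ^+ 2 != 0)%R by rewrite expf_neq0 ?U1_neq0.
apply: axis_fixed_Spin8.
- exact: (E6M _ _ (phi_E6 t) (Dz_E6 z)).
- by rewrite lin_isoME Dz_jE1 phi_jE1 t4 scale1r.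
- rewrite lin_isoME Dz_axis (lin_isoZ (phi_iso t)) phi_axis scalerA zt.
  by rewrite mulfV // scale1r.
- rewrite lin_isoME Dz_axisN (lin_isoZ (phi_iso t)) phi_axis scalerA zt.
  by rewrite -invfM -exprD t4 invr1 scale1r.
Qed.

Lemma kernel_ext x y :
  morph_kernel G p x -> morph_kernel G p y -> x.1 = y.1 -> x = y.
Proof.
move: x y => [x1 x2] [y1 y2] [_ px] [_ py] /= e; congr (_, _) => //.
by move: px py; rewrite /p /= e => /mulg1_eq <- /mulg1_eq <-.
Qed.

Lemma s2_kernel : morph_kernel G p s2.
Proof.
rewrite sigmaE; split.
  apply/U1P_spin; exists 1, n1, (Dz n1); split; last exact: erefl.
  rewrite -[Dz n1]mul1g -phi1; apply: Spin8_phi_Dz; first by rewrite expr1n.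
  by rewrite /= sqrrN.
by rewrite /p /= phi1 mul1g -DzM n1_sq Dz1.
Qed.

Lemma g4_kernel : morph_kernel G p g4.
Proof.
have V : (i1^-1%g : C) = (- 'i%C)%R.
  by rewrite -opp_i1.
split.
  apply/U1P_spin; exists i1, i1; eexists; split; last exact: erefl.
  apply: Spin8_phi_Dz => //; rewrite V -[4%N]/(2 * 2)%N exprM sqrrN sqr_i.
  by rewrite sqrrN expr1n.
rewrite /p /= -mulgA [Dz i1 * _]mulgA Dz_phi -mulgA -DzM mulgV Dz1 mulg1.
by rewrite -phiM mulgV phi1.
Qed.

Lemma U1_root4 t : ((t : C) ^+ 4 = 1)%R -> exists n, t = i1 ^+ n.
Proof.
move=> t4; have : (((t : C) ^+ 2) ^+ 2 == 1)%R by rewrite -exprM t4.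
rewrite sqrf_eq1 => /orP[] t2.
  move: t2; rewrite sqrf_eq1 => /orP[/eqP e|/eqP e].
    by exists 0%N; exact: U1_eqP.
  by exists 2%N; rewrite expg2 i1_sq; exact: U1_eqP.
move: t2; rewrite -(sqr_i R) -subr_eq0 subr_sqr mulf_eq0 subr_eq0 addr_eq0.
move=> /orP[/eqP e|/eqP e].
  by exists 1%N; exact: U1_eqP.
exists 3%N; rewrite expgS expg2 i1_sq; apply: U1_eqP.
by rewrite e /= mulrN mulr1.
Qed.

Lemma kernel_spin_product :
  setmul (@group_Z2 R) (@group_Z4 R) = morph_kernel G p.
Proof.
have [_ [K1 KM KV] _ _] := kernel_normal (G_subgroup R) (@spin_productM R).
have KX x n : morph_kernel G p x -> morph_kernel G p (x ^+ n).
  move=> Kx; elim: n => [|n IH]; first exact: K1.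
  by rewrite expgS; exact: (KM _ _ Kx IH).
rewrite group_Z2E group_Z4E; apply/seteqP; split=> x.
  move=> [_ [m _ <-] [_ [n _ <-] <-]].
  exact: (KM _ _ (KX _ m s2_kernel) (KX _ n g4_kernel)).
move=> Kx; have [/U1P_spin[t [z [b [bS xE]]]] px] := Kx.
rewrite xE in Kx px *; have [t4 zt] := spin_product_eq1 bS px.
have [n tn] := U1_root4 t4.
have [m zm] : exists m, Dz z = (s2 ^+ m).1.2 * Dz t /\ (s2 ^+ m).1.1 = 1.
  move/eqP: zt; rewrite -subr_eq0 subr_sqr mulf_eq0 subr_eq0 addr_eq0.
  move=> /orP[/eqP e|/eqP e].
    by exists 0%N; rewrite /= mul1g; split=> //; congr Dz; exact: U1_eqP.
  exists 1%N; rewrite /= sigmaE -DzM; split=> //; congr Dz; apply: U1_eqP.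
  by rewrite e /= mulN1r.
exists (s2 ^+ m); first by exists m.
exists (g4 ^+ n); first by exists n.
apply: kernel_ext (KM _ _ (KX _ m s2_kernel) (KX _ n g4_kernel)) Kx _.
apply: (congr2 pair); rewrite /= g4n_fst -tn; first by rewrite zm.2 mul1g.
by rewrite zm.1.
Qed.

End KernelIdentification.

(** * Topology *)

Section PointwiseTopology.
Variables (K : numFieldType).

Lemma cvg_initial (S : choiceType) (U : topologicalType) (h : S -> U)
    (T : Type) (F : set_system T) (g : T -> initial_topology h) s :
  Filter F -> (h \o g) x @[x --> F] --> h s ->
  g x @[x --> F] --> (s : initial_topology h).
Proof.
move=> FF cv A [_ [[B Bo <-] Bs] BA].
have FB : F ((h \o g) @^-1` B) := cv B (open_nbhs_nbhs (conj Bo Bs)).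
exact: (@filterS _ F FF _ (g @^-1` A) (fun x Bx => BA (g x) Bx) FB).
Qed.

Lemma cvg_lin_iso (V : normedModType K) (T : Type) (F : set_system T)
    (g : T -> lin_iso V) (f : lin_iso V) :
  Filter F -> (forall v, g x v @[x --> F] --> f v) -> g x @[x --> F] --> f.
Proof.
move=> FF cv; apply: (@cvg_initial _ {ptws V -> V}
  (fun k : lin_iso V => (k : {ptws V -> V})) T F g f FF).
by apply/(@pointwise_cvgP V V _ _ (fmap_filter _ FF)) => v; exact: cv.
Qed.

Lemma lin_iso_eval_continuous (V : normedModType K) (v : V) :
  continuous (fun f : lin_iso V => f v).
Proof.
move=> f; have := @initial_continuous (lin_iso V) _
  (fun x : lin_iso V => (x : {ptws V -> V})) f.
by move/(@pointwise_cvgP V V _ _ (fmap_filter _ (nbhs_filter f))) => /(_ v).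
Qed.

Definition finite_coordinates (V : normedModType K) : Prop :=
  exists n (e : 'I_n -> V) (c : 'I_n -> V -> K),
    (forall i, continuous (c i)) /\ forall v, v = \sum_i c i v *: e i.

Lemma finite_coordinates_regular : finite_coordinates (K^o : normedModType K).
Proof.
exists 1%N, (fun=> 1), (fun _ v => v); split; first by move=> i x.
by move=> v; rewrite big_ord1 /GRing.scale /= mulr1.
Qed.

Lemma finite_coordinates_prod (V W : normedModType K) :
  finite_coordinates V -> finite_coordinates W ->
  finite_coordinates ((V * W)%type : normedModType K).
Proof.
move=> [n [e [c [cc ce]]]] [m [d [b [bc be]]]].
exists (n + m)%N,
  (fun k => match fintype.split k with inl i => (e i, 0) | inr j => (0, d j) end),
  (fun k v => match fintype.split k with inl i => c i v.1 | inr j => b j v.2 end).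
split.
  move=> k; case: (fintype.split k) => [i|j] [v w].
    by apply: (@continuous_comp _ _ _ fst (c i)); [exact: cvg_fst | exact: cc].
  by apply: (@continuous_comp _ _ _ snd (b j)); [exact: cvg_snd | exact: bc].
move=> [v w]; rewrite big_split_ord /=.
under eq_bigr => i _ do rewrite (unsplitK (inl i)).
under [X in _ = _ + X]eq_bigr => j _ do rewrite (unsplitK (inr j)).
have E (I : finType) (a : I -> K) (x : I -> V) (y : I -> W) :
    \sum_i a i *: (x i, y i) = (\sum_i a i *: x i, \sum_i a i *: y i).
  elim/big_rec3: _ => // i u1 u2 u3 _ ->.
  by [].
rewrite !E -ce -be.
rewrite !big1; try by move=> i _; rewrite scaler0.
by apply: (congr2 pair); rewrite /= ?addr0 ?add0r.
Qed.

Lemma lin_iso_sum (V : normedModType K) (f : lin_iso V) (I : finType) (x : I -> V) :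
  f (\sum_i x i) = \sum_i f (x i).
Proof. exact: (big_morph f (lin_isoD f) (lin_iso0 f)). Qed.

Lemma cvg_eval (V : normedModType K) (T : Type) (F : set_system T)
    (g : T -> lin_iso V) (f : lin_iso V) (w : T -> V) (v : V) :
  finite_coordinates V -> Filter F ->
  g x @[x --> F] --> f -> w x @[x --> F] --> v -> g x (w x) @[x --> F] --> f v.
Proof.
move=> [n [e [c [cc ce]]]] FF gf wv.
have E (h : lin_iso V) (u : V) : h u = \sum_i c i u *: h (e i).
  by rewrite {1}(ce u) lin_iso_sum; apply: eq_bigr => i _; rewrite lin_isoZ.
rewrite E; under eq_cvg do rewrite E.
apply: cvg_big => [|i _]; first exact: add_continuous.
apply: cvgZ; first exact: (cvg_comp _ _ wv (cc i v)).
exact: (cvg_comp _ _ gf (@lin_iso_eval_continuous _ (e i) f)).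
Qed.

End PointwiseTopology.

Section FormLimits.
Variables (K : numFieldType) (V : normedModType K).
Variables (dot : V -> V -> K) (cross : V -> V -> V) (e a0 a1 : V).
Variables (T : Type) (F : set_system T) (FF : Filter F).

Lemma cvg_weight_form (k1 k2 k3 : T -> K) (l1 l2 l3 : K) v :
  k1 x @[x --> F] --> l1 -> k2 x @[x --> F] --> l2 -> k3 x @[x --> F] --> l3 ->
  weight_form dot cross e (k1 x) (k2 x) (k3 x) v @[x --> F] -->
  weight_form dot cross e l1 l2 l3 v.
Proof.
move=> c1 c2 c3; rewrite /weight_form.
by apply: cvgD; first apply: cvgD; apply: cvgZr_tmp.
Qed.

Lemma cvg_exprn (f : T -> K) (l : K) n :
  f x @[x --> F] --> l -> f x ^+ n @[x --> F] --> l ^+ n.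
Proof.
move=> fl; elim: n => [|n IH].
  by rewrite expr0; under eq_cvg do rewrite expr0; exact: cvg_cst.
by rewrite exprS; under eq_cvg do rewrite exprS; exact: cvgM.
Qed.

Lemma cvg_rot_form (r s : T -> K) (r0 s0 : K) v :
  r x @[x --> F] --> r0 -> s x @[x --> F] --> s0 ->
  rot_form dot cross e a0 a1 (r x) (s x) v @[x --> F] -->
  rot_form dot cross e a0 a1 r0 s0 v.
Proof.
move=> cr cs; rewrite /rot_form.
have cc (k : K) (h : T -> K) (h0 : K) : h x @[x --> F] --> h0 ->
    h x * k @[x --> F] --> h0 * k.
  by move=> ch; apply: cvgM => //; exact: cvg_cst.
have cl (k : K) (h : T -> K) (h0 : K) : h x @[x --> F] --> h0 ->
    k * h x @[x --> F] --> k * h0.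
  by move=> ch; apply: cvgM => //; exact: cvg_cst.
have cw : r x ^+ 2 - s x ^+ 2 - 1 @[x --> F] --> r0 ^+ 2 - s0 ^+ 2 - 1.
  apply: cvgB; last exact: cvg_cst.
  by apply: cvgB; exact: cvg_exprn.
have crs : 2 * r x * s x @[x --> F] --> 2 * r0 * s0.
  by apply: cvgM => //; exact: cl.
apply: cvgD; first apply: cvgD; first apply: cvgD.
- by apply: cvg_weight_form => //; exact: cvg_cst.
- by apply: cvgZr_tmp; apply: (cc _ _ _); apply: cvgD; exact: cc.
- by apply: cvgZr_tmp; apply: (cc _ _ _); apply: cvgB; exact: cc.
- by apply: cvgZr_tmp; exact: cl.
Qed.

End FormLimits.

Lemma nbhs_dist_lt (K : numFieldType) (x : K) (B : set K) : nbhs x B ->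
  exists2 e : K, 0 < e & forall y, `|x - y| < e -> B y.
Proof.
by move=> /nbhs_ballP[e /= e0 xB]; exists e.
Qed.

Lemma cvg_dist_lt (K : numFieldType) (T : topologicalType) (f : T -> K) (x : T)
    (e : K) : continuous f -> 0 < e -> \forall y \near x, `|f x - f y| < e.
Proof. by move=> cf e0; apply: cvgr_dist_lt => //; exact: cf. Qed.

Section UnitCircleTopology.
Variable R : realType.
Local Notation K := (R[i] : numFieldType).
Implicit Types t z u : U1 R.

Lemma U1_val_continuous : continuous ((fun z => (z : R[i])) : U1 R -> K).
Proof. exact: (@initial_continuous (U1 R) _ (@U1_val R : U1 R -> K)). Qed.

Lemma U1_nbhsP u (P : set (U1 R)) : nbhs u P ->
  exists2 B : set K, nbhs (u : K) B & forall w : U1 R, B (w : K) -> P w.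
Proof.
move=> [_ [[B Bo <-] Bu] BP]; exists B; last exact: BP.
exact: open_nbhs_nbhs.
Qed.

Lemma U1V z : ((z^-1)%g : R[i]) = (z : R[i])^-1.
Proof. by rewrite -U1_conj. Qed.

Lemma U1_norm z : `|z : R[i]| = 1.
Proof.
apply/eqP; rewrite -(@eqrXn2 _ 2) ?normr_ge0 // expr1n sqr_normc mulrC.
exact: U1P.
Qed.

Lemma U1_inv_continuous : continuous (fun z : U1 R => (z^-1)%g).
Proof.
move=> z; apply: (@cvg_initial _ K (@U1_val R : U1 R -> K) _ (nbhs z)
  (fun w : U1 R => (w^-1)%g) (z^-1)%g (nbhs_filter z)).
have E : (fun w : U1 R => (w : R[i])^-1 : K) =1
    (fun w : U1 R => ((w^-1)%g : R[i]) : K) by move=> w; rewrite U1V.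
have := @cvgV K _ (nbhs z) (nbhs_filter z) _ _ (U1_neq0 z) (@U1_val_continuous z).
by rewrite (eq_cvg _ _ E) -U1V.
Qed.

(* If [s^2] is close to [z^2], then [s] or [- s] is close to [z], because
   [|s - z| + |s + z| >= 2]. *)
Lemma U1_sqr_open z (P : set (U1 R)) : nbhs z P ->
  \forall w \near (z * z)%g, exists2 s, P s & (s * s)%g = w.
Proof.
move=> /U1_nbhsP[B /nbhs_dist_lt[e e0 zB] BP].
have close (s : U1 R) : `|(z : R[i]) - (s : R[i])| < e -> P s.
  by move=> zs; apply: BP; exact: zB.
apply: (@filterS _ _ (nbhs_filter _) _ _ _
  (cvg_dist_lt (z * z)%g U1_val_continuous e0)) => w zw.
have [s s2] := U1_sqrt w.
have sP : (s * s)%g = w by apply: U1_eqP; rewrite -s2.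
have prod : `|(z : R[i]) - (s : R[i])| * `|(z : R[i]) + (s : R[i])| < e.
  by rewrite -normrM -subr_sqr expr2 s2.
have sum : 2 <= `|(z : R[i]) - (s : R[i])| + `|(z : R[i]) + (s : R[i])|.
  apply: le_trans (ler_normD _ _).
  by rewrite addrACA addNr addr0 -mulr2n normrMn U1_norm.
have rl (x : R[i]) : `|x| \is Num.real := normr_real x.
have [ge1 | lt1] := real_leP (real1 _) (rl ((z : R[i]) + (s : R[i]))).
  exists s => //; apply: close; apply: le_lt_trans prod.
  by rewrite ler_peMr.
exists (U1_opp s); last by apply: U1_eqP; rewrite /= mulrNN -s2.
apply: close; rewrite /= opprK; apply: le_lt_trans prod.
rewrite ler_peMl //.
have : 1 + `|(z : R[i]) + (s : R[i])| <=
    `|(z : R[i]) - (s : R[i])| + `|(z : R[i]) + (s : R[i])|.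
  by apply: le_trans sum; rewrite -[2]/(1 + 1) lerD2l ltW.
by rewrite lerD2r.
Qed.

End UnitCircleTopology.

Lemma fst_fst_continuous (X Y Z : topologicalType) :
  continuous (fun x : X * Y * Z => x.1.1).
Proof. by move=> x; apply: (@continuous_comp _ _ _ fst fst); exact: cvg_fst. Qed.

Lemma fst_snd_continuous (X Y Z : topologicalType) :
  continuous (fun x : X * Y * Z => x.1.2).
Proof.
move=> x; apply: (@continuous_comp _ _ _ fst snd); [exact: cvg_fst | exact: cvg_snd].
Qed.

Lemma comp_continuous (X Y Z : topologicalType) (g : X -> Y) (h : Y -> Z) :
  continuous g -> continuous h -> continuous (h \o g).
Proof. by move=> cg ch x; apply: continuous_comp; [exact: cg | exact: ch]. Qed.

Section LiftTopology.
Variables (R : realType) (L X : topologicalType).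
Local Notation K := (R[i] : numFieldType).
Variables (ev : L -> X -> X) (mul : L -> L -> L) (phi D : U1 R -> L).
Hypotheses (mulE : forall f g v, ev (mul f g) v = ev f (ev g v))
  (cvg_ev : forall (I : Type) (F : set_system I) (g : I -> L) f (w : I -> X) v,
     Filter F -> g x @[x --> F] --> f -> w x @[x --> F] --> v ->
     ev (g x) (w x) @[x --> F] --> ev f v)
  (ev_cvg : forall (I : Type) (F : set_system I) (g : I -> L) f, Filter F ->
     (forall v, ev (g x) v @[x --> F] --> ev f v) -> g x @[x --> F] --> f)
  (phi_cont : continuous phi) (D_cont : continuous D).
Local Notation T := (U1 R * L * L)%type.
Variables (G : set T) (H : set L).

Definition lift_product (x : T) : L := mul (mul (phi x.1.1) x.1.2) x.2.

Definition lift (t z : U1 R) (f : L) : T :=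
  (t, D z, mul (D z^-1%g) (mul (phi t^-1%g) f)).

Variables (c1 c2 : X -> K) (e1 e2 : X).
Hypotheses (c1_cont : continuous c1) (c2_cont : continuous c2).
Hypothesis product_in : forall x, G x -> H (lift_product x).
Hypothesis liftP : forall f, H f -> exists u l : U1 R,
  [/\ c1 (ev f e1) = u, c2 (ev f e2) = l & forall t z : U1 R,
    ((t * t) * (t * t))%g = u -> (z * z)%g = (t * t * l)%g ->
    G (lift t z f) /\ lift_product (lift t z f) = f].

Lemma mul_continuous (Y : topologicalType) (g h : Y -> L) :
  continuous g -> continuous h -> continuous (fun y => mul (g y) (h y)).
Proof.
move=> cg ch y; apply: (@ev_cvg _ (nbhs y) _ _ (nbhs_filter y)) => v.
rewrite mulE; under eq_cvg do rewrite mulE.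
apply: (@cvg_ev _ (nbhs y) _ _ _ _ (nbhs_filter y) (cg y)).
exact: (@cvg_ev _ (nbhs y) _ _ _ _ (nbhs_filter y) (ch y) (cvg_cst v)).
Qed.

Lemma lift_product_continuous : continuous lift_product.
Proof.
apply: mul_continuous; last by move=> x; exact: cvg_snd.
apply: mul_continuous; last exact: fst_snd_continuous.
exact: (comp_continuous (@fst_fst_continuous _ _ _) phi_cont).
Qed.

Lemma lift_continuous : continuous (fun x : U1 R * U1 R * L => lift x.1.1 x.1.2 x.2).
Proof.
have c1' := @fst_fst_continuous (U1 R) (U1 R) L.
have c2' := @fst_snd_continuous (U1 R) (U1 R) L.
have cV := @U1_inv_continuous R.
have c3 : continuous (fun x : U1 R * U1 R * L =>
      mul (D x.1.2^-1%g) (mul (phi x.1.1^-1%g) x.2)).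
  apply: mul_continuous.
    exact: (comp_continuous (comp_continuous c2' cV) D_cont).
  apply: mul_continuous; last by move=> x; exact: cvg_snd.
  exact: (comp_continuous (comp_continuous c1' cV) phi_cont).
move=> x; have c2D := comp_continuous c2' D_cont.
exact: (cvg_pair (cvg_pair (c1' x) (c2D x)) (c3 x)).
Qed.

Lemma coordinate_continuous (c : X -> K) (e : X) : continuous c ->
  continuous (fun f : L => c (ev f e)).
Proof.
move=> cc; apply: (comp_continuous (g := fun f : L => ev f e)) cc.
move=> f; exact: (@cvg_ev _ (nbhs f) id _ _ _ (nbhs_filter f) cvg_id (cvg_cst e)).
Qed.

(* For [g] near [f], square roots [t] and [z] exist near those chosen for [f]. *)
Lemma lift_local f (O : set T) : H f -> (forall t z, G (lift t z f) ->
    lift_product (lift t z f) = f -> nbhs (lift t z f) O) ->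
  \forall g \near f, H g -> exists x, [/\ G x, O x & lift_product x = g].
Proof.
move=> Hf fO; have [u0 [l0 [c1u c2l fP]]] := liftP Hf.
have [s0 s02] := U1_sqrt u0; have [t0 t02] := U1_sqrt s0.
have [z0 z02] := U1_sqrt (t0 * t0 * l0)%g.
have t0E : ((t0 * t0) * (t0 * t0))%g = u0.
  by apply: U1_eqP; rewrite -s02 -t02 /= !expr2.
have z0E : (z0 * z0)%g = (t0 * t0 * l0)%g by apply: U1_eqP; rewrite -z02 expr2.
have [Gx px] := fP t0 z0 t0E z0E.
have := @lift_continuous (t0, z0, f) O (fO _ _ Gx px).
case=> -[W A] /= [[[W1 W2] /= [nW1 nW2] W12] nA] WA.
have [B2 nB2 B2P] := U1_nbhsP (U1_sqr_open nW2).
have cm : continuous (fun x : U1 R * L => (x.1 : K) * (x.1 : K) * c2 (ev x.2 e2)).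
  have cf : continuous (fst : U1 R * L -> U1 R) by move=> x; exact: cvg_fst.
  have cs : continuous (snd : U1 R * L -> L) by move=> x; exact: cvg_snd.
  have cv := comp_continuous cf (@U1_val_continuous R).
  have cc := comp_continuous cs (@coordinate_continuous c2 e2 c2_cont).
  by move=> x; exact: (cvgM (cvgM (cv x) (cv x)) (cc x)).
have nB2' : nbhs ((t0 : K) * (t0 : K) * c2 (ev f e2)) B2.
  by rewrite c2l -[X in nbhs X](congr1 (@U1_val R) z0E).
have [[T1 A2] /= [nT1 nA2] TA] := cm (t0, f) B2 nB2'.
have [B1 nB1 B1P] := U1_nbhsP (U1_sqr_open (U1_sqr_open (filterI nW1 nT1))).
have nA3 : nbhs f (fun g : L => B1 (c1 (ev g e1))).
  apply: (@coordinate_continuous c1 e1 c1_cont); rewrite /= c1u -t0E; exact: nB1.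
apply: filterS (filterI nA (filterI nA2 nA3)) => g [Ag [A2g B1g]] Hg.
have [u [l [gu gl gP]]] := liftP Hg.
have [s [t [W1t T1t] ts] su] := B1P u (eq_ind _ B1 B1g _ gu).
have [z W2z zE] : exists2 z, W2 z & (z * z)%g = (t * t * l)%g.
  by apply: B2P; have := TA (t, g) (conj T1t A2g); rewrite /= gl.
have [Gl pl] : G (lift t z g) /\ lift_product (lift t z g) = g.
  by apply: gP zE; rewrite ts.
exists (lift t z g); split=> //.
by apply: (WA (t, z, g)); split=> //=; exact: (W12 (t, z)).
Qed.

Lemma lift_quotient_map (q : T -> L) : (forall x, G x -> q x = lift_product x) ->
  topological_quotient_map G H q.
Proof.
move=> qE U; split.
  move=> /open_subspaceP[W oW WH]; apply/open_subspaceP.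
  exists (lift_product @^-1` W).
    by have /continuousP pW := lift_product_continuous; exact: pW.
  have UW y : H y -> W y <-> U y.
    move=> Hy; have E : (W `&` H) y = (U `&` H) y by rewrite WH.
    split=> [Wy | Uy].
      by have [] : (U `&` H) y by rewrite -E.
    by have [] : (W `&` H) y by rewrite E.
  apply/seteqP; split=> x [Wx Gx]; split=> //; move: Wx; rewrite /preimage /= qE //;
    by have := UW _ (product_in Gx); tauto.
move=> /open_subspaceP[W oW WG].
rewrite openE => f Uf; have [Hf | nHf] := pselect (H f); last first.
  have : globally [set f] U by move=> _ ->.
  by rewrite (@nbhs_subspace_out L H f nHf); exact.
suff : within H (nbhs (f : L)) U by rewrite (@nbhs_subspace_in L H f Hf); exact.
apply: filterS (lift_local (O := W) Hf _) => [g gP Hg | t z Gx px].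
  have [x [Gx Wx <-]] := gP Hg.
  have [] : (q @^-1` U `&` G) x by rewrite -WG.
  by rewrite /preimage /= qE.
apply: open_nbhs_nbhs; split=> //.
have [] // : (W `&` G) (lift t z f).
by rewrite WG; split=> //; rewrite /preimage /= qE // px.
Qed.

End LiftTopology.

Section AbstractContinuity.
Variables (R : realType).
Local Notation K := (R[i] : numFieldType).
Variables (V : normedModType K) (phi : U1 R -> lin_iso V).
Variables (dot : V -> V -> K) (cross : V -> V -> V) (e a0 a1 : V).

Lemma Re_U1 (z : U1 R) : (complex.Re z)%:C = ((z : R[i]) + (z : R[i])^-1) / 2.
Proof.
rewrite -(U1_complexVE z) mulrN -{2}(U1_complexE z).
have two0 := complex2_neq0 R.
by field.
Qed.

Lemma Im_U1 (z : U1 R) :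
  (complex.Im z)%:C = ((z : R[i]) - (z : R[i])^-1) / (2 * 'i%C).
Proof.
have i0 : 'i%C != 0 :> R[i] by rewrite -sqrf_eq0 sqr_i oppr_eq0 oner_neq0.
have two0 := complex2_neq0 R.
rewrite -(U1_complexVE z) mulrN -{2}(U1_complexE z).
by field; rewrite ?i0 ?two0.
Qed.

Let val_cont := @U1_val_continuous R.
Let inv_cont (t : U1 R) :=
  @cvgV K _ (nbhs t) (nbhs_filter t) _ _ (U1_neq0 t) (@val_cont t).

Lemma weight_iso_continuous :
  (forall t v, phi t v = weight_form dot cross e
    ((t : R[i]) ^+ 4) ((t : R[i]) ^- 2) (t : R[i]) v) -> continuous phi.
Proof.
move=> phiE t; apply: (@cvg_lin_iso K V _ _ _ _ (nbhs_filter t)) => v.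
rewrite phiE; under eq_cvg do rewrite phiE.
apply: cvg_weight_form; last exact: val_cont.
- exact: (@cvg_exprn _ _ _ (nbhs_filter t) _ _ _ (@val_cont t)).
- have := @cvg_exprn K _ _ (nbhs_filter t) _ _ 2 (@inv_cont t).
  have E (s : U1 R) : (s : R[i])^-1 ^+ 2 = (s : R[i]) ^- 2 by rewrite exprVn.
  by rewrite (eq_cvg _ _ E) E.
Qed.

Lemma rot_iso_continuous :
  (forall t v, phi t v = rot_form dot cross e a0 a1
    ((complex.Re t)%:C) ((complex.Im t)%:C) v) -> continuous phi.
Proof.
move=> phiE t; apply: (@cvg_lin_iso K V _ _ _ _ (nbhs_filter t)) => v.
rewrite phiE; under eq_cvg do rewrite phiE.
apply: cvg_rot_form.
- rewrite Re_U1; under eq_cvg do rewrite Re_U1.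
  apply: (cvgM (cvgD (@val_cont t) (@inv_cont t))); exact: cvg_cst.
- rewrite Im_U1; under eq_cvg do rewrite Im_U1.
  apply: (cvgM (cvgB (@val_cont t) (@inv_cont t))); exact: cvg_cst.
Qed.

End AbstractContinuity.

Section LiftQuotient.
Variable R : realType.
Local Notation K := (R[i] : numFieldType).

Lemma coordinates_continuous (V : normedModType K) (c : V -> K) :
  finite_coordinates V -> (forall k u v, c (k *: u + v) = k * c u + c v) ->
  continuous c.
Proof.
move=> [n [e [b [bc be]]]] cL v.
have c0 : c 0 = 0.
  have := cL 1 0 0; rewrite scale1r addr0 mul1r => /eqP.
  by rewrite addrC -subr_eq subrr eq_sym => /eqP.
have E (u : V) : c u = \sum_i b i u * c (e i).
  rewrite {1}(be u) (big_morph c (id1 := 0) (op1 := +%R)) //; last first.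
    by move=> x y; rewrite -{1}[x]scale1r cL mul1r.
  by apply: eq_bigr => i _; rewrite -[_ *: _]addr0 cL c0 addr0.
rewrite /continuous_at E; under eq_cvg do rewrite E.
apply: cvg_big => [|i _]; first exact: add_continuous.
apply: cvgM; [exact: bc | exact: cvg_cst].
Qed.

(* The module [jordan C] is convertible to the one underlying its normed-module
   structure, but the conversion is costly; transporting along an equation [E]
   restricts it to one proof [E := erefl]. *)
Definition quotient_map_along (V : normedModType K) (W : lmodType K)
    (E : (V : lmodType K) = W) :
    set (U1 R * lin_iso W * lin_iso W) -> set (lin_iso W) ->
    (U1 R * lin_iso W * lin_iso W -> lin_iso W) -> Prop :=
  match E in _ = W' return set (U1 R * lin_iso W' * lin_iso W') ->
    set (lin_iso W') -> (U1 R * lin_iso W' * lin_iso W' -> lin_iso W') -> Prop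
  with erefl => fun G H q => @topological_quotient_map
    (U1 R * lin_iso V * lin_iso V)%type (lin_iso V) G H q end.

Section Along.
Variables (V : normedModType K) (W : lmodType K) (E : (V : lmodType K) = W).
Variables (phi D : U1 R -> lin_iso W) (dot : W -> W -> K) (cross : W -> W -> W).
Variables (e a0 a1 e1 e2 : W) (c1 c2 : W -> K).
Local Notation T := (U1 R * lin_iso W * lin_iso W)%type.
Variables (G : set T) (H : set (lin_iso W)) (q : T -> lin_iso W).

Lemma lift_quotient_map_along : finite_coordinates V ->
  (forall t v, phi t v = weight_form dot cross e
    ((t : R[i]) ^+ 4) ((t : R[i]) ^- 2) (t : R[i]) v) ->
  (forall t v, D t v = rot_form dot cross e a0 a1
    ((complex.Re t)%:C) ((complex.Im t)%:C) v) ->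
  (forall k u v, c1 (k *: u + v) = k * c1 u + c1 v) ->
  (forall k u v, c2 (k *: u + v) = k * c2 u + c2 v) ->
  (forall x, G x -> H (phi x.1.1 * x.1.2 * x.2)%g) ->
  (forall f, H f -> exists u l : U1 R, [/\ c1 (f e1) = u, c2 (f e2) = l &
     forall t z : U1 R, ((t * t) * (t * t))%g = u -> (z * z)%g = (t * t * l)%g ->
     let x := (t, D z, (D z^-1 * (phi t^-1 * f))%g) in
     G x /\ (phi x.1.1 * x.1.2 * x.2)%g = f]) ->
  (forall x, G x -> q x = (phi x.1.1 * x.1.2 * x.2)%g) ->
  quotient_map_along E G H q.
Proof.
case: _ / E phi D dot cross e a0 a1 e1 e2 c1 c2 G H q => phi' D' dot' cross' e'
  a0' a1' e1' e2' c1' c2' G' H' q' Vf phiE DE c1L c2L GH HG qE.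
apply: (@lift_quotient_map R (lin_iso V) V (fun f v => f v) (fun f g => (f * g)%g)
  phi' D' (fun _ _ _ => erefl) _ _ (weight_iso_continuous phiE)
  (rot_iso_continuous DE) G' H' c1' c2' e1' e2' (coordinates_continuous Vf c1L)
  (coordinates_continuous Vf c2L) GH HG q' qE).
- by move=> I F g f w v FF; exact: (@cvg_eval K V I F g f w v Vf FF).
- by move=> I F g f FF; exact: (@cvg_lin_iso K V I F g f FF).
Qed.

End Along.
End LiftQuotient.

Section SpinTopology.
Variable R : realType.
Local Notation C := R[i].
Local Notation JC := (jordan C).
Local Notation K := (R[i] : numFieldType).
Local Notation JN := (jordan C : normedModType K).
Local Notation L := (lin_iso JC).
Local Notation G := (@U1_Spin2_Spin8 R).

Lemma jordan_coordinates : finite_coordinates JN.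
Proof.
repeat refine (@finite_coordinates_prod K _ _ _ _).
all: exact: finite_coordinates_regular.
Qed.

Lemma jordan_xi1_linear (k : C) (u v : JC) :
  (k *: u + v).1.1.1.1.1 = k * u.1.1.1.1.1 + v.1.1.1.1.1.
Proof.
move: u v => [[[[[u1 u2] u3] x] y] z] [[[[[v1 v2] v3] x'] y'] z'].
rewrite jscaleE jaddE; exact: erefl.
Qed.

Lemma jordan_x1_linear (k : C) (u v : JC) :
  (k *: u + v).1.1.2 = k *: u.1.1.2 + v.1.1.2.
Proof.
move: u v => [[[[[u1 u2] u3] x] y] z] [[[[[v1 v2] v3] x'] y'] z'].
rewrite jscaleE jaddE; exact: erefl.
Qed.

Lemma cayley_re_linear (k : C) (u v : cayley C) :
  (k *: u + v).1.1.1.1 = k * u.1.1.1.1 + v.1.1.1.1.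
Proof. by move: u v => [[[[a b] c] d] e] [[[[a' b'] c'] d'] e']; exact: erefl. Qed.

Lemma jordan_x1_re_linear (k : C) (u v : JC) :
  (k *: u + v).1.1.2.1.1.1.1 = k * u.1.1.2.1.1.1.1 + v.1.1.2.1.1.1.1.
Proof. rewrite jordan_x1_linear cayley_re_linear; exact: erefl. Qed.

Definition jordan_lmodE : (JN : lmodType K) = (JC : lmodType K) := erefl.

Lemma spin_liftP (f : L) : E6_fix (sigma3 R) f -> exists u l : U1 R,
  [/\ (f (jE1 C)).1.1.1.1.1 = u, (f (axis 'i%C)).1.1.2.1.1.1.1 = l &
    forall t z : U1 R, ((t * t) * (t * t))%g = u -> (z * z)%g = (t * t * l)%g ->
    let x := (t, Dz z, (Dz z^-1 * (phi_iso t^-1 * f))%g) in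
    G x /\ spin_product x = f].
Proof.
move=> fs; have [fE _] := fs.
have [u [l [m [fe fl fm ulm]]]] := E6_fix_sigma3_axes fs.
exists u, l; split.
- by rewrite fe scale_jE1.
- by rewrite fl scale_axis.
- move=> t z t4 z2; apply: (spin_lift fE fe fl fm ulm).
    by rewrite -t4 /=; ring.
  by rewrite expr2 -[LHS]/(((z * z)%g : U1 R) : C) z2 /= expr2.
Qed.

Lemma spin_product_quotient_map (q : U1 R * L * L -> L) :
  (forall x, G x -> q x = spin_product x) ->
  quotient_map_along jordan_lmodE G (E6_fix (sigma3 R)) q.
Proof.
move=> qE.
apply: (@lift_quotient_map_along R JN JC jordan_lmodE (@phi_iso R) (@Dz R)
  _ _ _ _ _ (jE1 C) (axis 'i%C) (fun X => X.1.1.1.1.1) (fun X => X.1.1.2.1.1.1.1)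
  G (E6_fix (sigma3 R)) q jordan_coordinates (@phi_weight R) (@Dz_rot_form R)
  jordan_xi1_linear jordan_x1_re_linear _ spin_liftP qE).
move=> x Gx; rewrite -range_spin_product; by exists x.
Qed.

Lemma E6_fix_sigma3_mu3_quotient :
  let H := E6_fix (sigma3 R) `&` E6_fix (mu3 R) in
  let N := setmul (@group_Z2 R) (@group_Z4 R) in
  [/\ H = E6_fix (sigma3 R),
      direct_subgroups (@group_Z2 R) (@group_Z4 R),
      normal_subgroup N G &
      exists f : set (U1 R * L * L) -> L,
        quotient_isomorphism G N H f /\
        quotient_map_along jordan_lmodE G H (f \o coset_by N)].
Proof.
move=> H N.
have HE : H = E6_fix (sigma3 R) by exact: E6_fix_mu3_sigma3.
have NE : N = morph_kernel G (@spin_product R) by exact: kernel_spin_product.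
have GS := G_subgroup R; have pM := @spin_productM R.
split; first exact: HE.
- exact: Z2_Z4_direct.
- by rewrite NE; exact: (kernel_normal GS pM).
exists (coset_morph (@spin_product R)); rewrite HE NE; split.
  exact: (coset_morph_isomorphism GS pM (range_spin_product R)).
apply: spin_product_quotient_map => x Gx /=.
exact: (coset_morphE GS pM Gx).
Qed.

End SpinTopology.

Local Close Scope complex_scope.

Theorem theorem4p10p2 (R : realType) :
  let H := E6_fix (sigma3 R) `&` E6_fix (mu3 R) in
  let G := @U1_Spin2_Spin8 R in
  let N := setmul (@group_Z2 R) (@group_Z4 R) in
  [/\ H = E6_fix (sigma3 R),
      direct_subgroups (@group_Z2 R) (@group_Z4 R),
      normal_subgroup N G &
      exists f : set (U1 R * lin_iso (jordan R[i]) * lin_iso (jordan R[i])) ->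
                 lin_iso (jordan R[i]),
        quotient_isomorphism G N H f /\
        topological_quotient_map G H (f \o coset_by N)].
Proof. exact: (E6_fix_sigma3_mu3_quotient R). Qed.
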